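(* Let $K$ be an algebraically closed field of characteristic $0$, let $r\ge 2$ be an integer, and set $A=K[x_1,\dots ,x_r]/(\ell_1^2,\dots ,\ell_{r+1}^2)$, where $\ell_1,\dots,\ell_{r+1}$ are general linear forms in $K[x_1,\dots,x_r]$. Then: \begin{itemize} \item[(1)] If $2\le r\le 5$ or $r=7$, then $A$ has the Weak Lefschetz Property. \item[(2)] If $r=6$ or $r\ge 8$, then $A$ fails the Weak Lefschetz Property. \end{itemize}
   Context: The polynomial ring $K[x_1,\dots,x_r]$ has the standard grading. A graded artinian $K$-algebra $A=R/I$ ($R=K[x_1,\dots,x_r]$, $I$ a homogeneous ideal) has the Weak Lefschetz Property (WLP) if there is a linear form $L\in[A]_1$ such that, for all integers $i\ge 0$, the multiplication map $\times L:[A]_i\to[A]_{i+1}$ has maximal rank, i.e. is injective or surjective; here $[A]_i$ denotes the degree-$i$ graded component. $A$ fails the WLP if it does not have it. ''General linear forms'' means that the assertion holds for all $(\ell_1,\dots,\ell_{r+1})$ in some nonempty Zariski-open subset of the affine space $([R]_1)^{r+1}$ of $(r+1)$-tuples of linear forms. *)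

(* Defs.v *)
From HB Require Import structures.
From mathcomp Require Import all_boot all_order all_algebra.
From mathcomp Require Import ring_quotient.
From mathcomp Require Import boolp.
From mathcomp Require Import mpoly.

Set Implicit Arguments.
Unset Strict Implicit.
Unset Printing Implicit Defensive.

Import GRing.Theory.

Local Open Scope ring_scope.
Local Open Scope quotient_scope.

Definition graded_piece (K : fieldType) (r : nat) (I : idealr {mpoly K[r]})
    (d : nat) (a : {ideal_quot I}) : Prop :=
  exists2 p : {mpoly K[r]}, p \is d.-homog & a = \pi_({ideal_quot I}) p.

(* Meant for homogeneous I with artinian quotient: these two standing
   assumptions are not part of the predicate, so that its negation is
   exactly the failure of maximal rank, for every L, in some degree. *)
Definition has_WLP (K : fieldType) (r : nat) (I : idealr {mpoly K[r]}) : Prop :=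
  exists2 L : {ideal_quot I}, graded_piece 1 L &
    forall d : nat,
      (forall a b : {ideal_quot I},
          graded_piece d a -> graded_piece d b -> L * a = L * b -> a = b)
      \/
      (forall c : {ideal_quot I}, graded_piece d.+1 c ->
          exists2 a : {ideal_quot I}, graded_piece d a & L * a = c).

Definition linear_forms (K : fieldType) (m r : nat) : Type :=
  'I_m -> dhomog r K 1.

Definition square_ideal (K : fieldType) (m r : nat) (l : linear_forms K m r) :
    {pred {mpoly K[r]}} :=
  fun p => `[< exists g : 'I_m -> {mpoly K[r]},
                 p = \sum_(i < m) g i * (l i : {mpoly K[r]}) ^+ 2 >].

Lemma square_ideal_closed (K : fieldType) (m r : nat) (l : linear_forms K m r) :
  idealr_closed (square_ideal l).
Proof.
split.
- apply/asboolP; exists (fun=> 0).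
  by rewrite big1 // => i _; rewrite mul0r.
- apply/asboolP => -[g /(congr1 (mcoeff 0%MM))].
  rewrite mcoeff1 eqxx raddf_sum big1 /=; first by move/eqP; rewrite oner_eq0.
  move=> i _; rewrite !rmorphM /= (_ : (l i : {mpoly K[r]})@_0%MM = 0).
    by rewrite mulr0 mulr0.
  by apply: (@dhomog_nemf_coeff _ _ mdeg 1);
    [exact: dhomog_is_dhomog | rewrite mf0].
- move=> a p q /asboolP[g ->] /asboolP[h ->]; apply/asboolP.
  exists (fun i => a * g i + h i); rewrite mulr_sumr -big_split /=.
  by apply: eq_bigr => i _; rewrite mulrDl mulrA.
Qed.

HB.instance Definition _ (K : fieldType) (m r : nat) (l : linear_forms K m r) :=
  isIdealr.Build {mpoly K[r]} (square_ideal l) (square_ideal_closed l).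

(* The coordinates of l in the affine space of m-tuples of linear forms are
   the coefficients of 'X_j in l i, listed in the order of mxvec. *)
Definition coordinates (K : fieldType) (m r : nat) (l : linear_forms K m r) :
    'I_(m * r) -> K :=
  fun k => mxvec (\matrix_(i < m, j < r) (l i : {mpoly K[r]})@_(U_(j))%MM) 0 k.

Definition zariski_open (K : fieldType) (m r : nat)
    (U : linear_forms K m r -> Prop) : Prop :=
  exists S : {mpoly K[m * r]} -> Prop,
    forall l : linear_forms K m r,
      U l <-> exists2 f : {mpoly K[m * r]}, S f & f.@[coordinates l] != 0.

Definition for_general_linear_forms (K : fieldType) (m r : nat)
    (P : linear_forms K m r -> Prop) : Prop :=
  exists U : linear_forms K m r -> Prop,
    [/\ zariski_open U, exists l, U l & forall l, U l -> P l].

(* Main.v *)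
(* Rescaling r+1 general linear forms so that they add up to 0, A becomes
   K[y_0..y_r]/(y_0^2, .., y_r^2, sigma) with sigma = y_0 + .. + y_r; write
   n = r+1. Since sigma acts injectively on the squarefree algebra below the
   middle degree, dim A_d = C(n,d) - C(n,d-1) there, and multiplication by
   L = sum a_i y_i from A_d to A_(d+1) has maximal rank exactly when the space
   V of squarefree forms of degree d+1 killed by sum d/dy_i and
   sum a_i d/dy_i has dimension max(0, C(n,d+1) - 2 C(n,d) + C(n,d-1)).

   Failure: for distinct a_i, Lagrange interpolation shows that
   sum_T prod_(i in T, j notin T) (a_i - a_j)^-1 y_T, over the sets T of
   cardinal d+1, lies in V as soon as 2(d+1) < n. With d+1 = floor(r/2) this
   already makes V too large, except for r = 9 and r = 11; there, products of
   two such forms in complementary sets of variables give 16 > 15 and 23 > 22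
   independent elements of V. Semicontinuity of the rank covers the a with
   repetitions.

   Maximal rank: for r = 2, 3, 4, 5, 7 take a_i = i and compute dim V by
   integer elimination; surjectivity propagates to higher degrees. *)

Require Import Defs.
From Stdlib Require Import ZArith.
From HB Require Import structures.
From mathcomp Require Import all_boot all_order all_algebra.
From mathcomp Require Import ring_quotient mpoly.
From mathcomp Require Import boolp zify ring ssrZ.

Import GRing.Theory.
Local Open Scope ring_scope.

Set Implicit Arguments.
Unset Strict Implicit.
Unset Printing Implicit Defensive.

(** * Multiplication by a linear form on squarefree monomials *)

Definition layer (n d : nat) : {set {set 'I_n}} := [set T : {set 'I_n} | #|T| == d].

(* Multiplication by [\sum_x a x *: 'X_x] from degree [d] to degree [d.+1] in
   [R['X_0, ..., 'X_(n-1)] / ('X_0 ^+ 2, ..., 'X_(n-1) ^+ 2)], acting on row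
   vectors in the basis of squarefree monomials; column vectors are the dual
   picture, squarefree forms on which it acts by [\sum_x a x *: d/d'X_x]. *)
Definition up (R : nzRingType) (n d : nat) (a : 'I_n -> R) :
    'M[R]_(#|layer n d|, #|layer n d.+1|) :=
  \matrix_(i < #|layer n d|, j < #|layer n d.+1|)
    let S := enum_val i in let T := enum_val j in
    \sum_(x in T | T :\ x == S) a x.

Lemma card_layer n d : #|layer n d| = 'C(n, d).
Proof. by rewrite card_draws card_ord. Qed.

Lemma in_layer n d (T : {set 'I_n}) : (T \in layer n d) = (#|T| == d).
Proof. by rewrite inE. Qed.

Lemma card_enum_val_layer n d (i : 'I_#|layer n d|) : #|enum_val i| = d.
Proof. by apply/eqP; rewrite -in_layer; apply: enum_valP. Qed.

Lemma layer_setD1 n d (T : {set 'I_n}) x :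
  T \in layer n d.+1 -> x \in T -> T :\ x \in layer n d.
Proof. by rewrite !in_layer (cardsD1 x) => + xT; rewrite xT. Qed.

Lemma layer_setU1 n d (S : {set 'I_n}) x :
  S \in layer n d -> x \notin S -> x |: S \in layer n d.+1.
Proof. by rewrite !in_layer cardsU1 => + ->. Qed.

Section Up.
Variables (R : nzRingType) (n : nat).
Implicit Types (d : nat) (a : 'I_n -> R) (g : {set 'I_n} -> R).

Definition row_of d g : 'rV[R]_#|layer n d| := \row_i g (enum_val i).
Definition col_of d g : 'cV[R]_#|layer n d| := \col_i g (enum_val i).

(** A sum with at most one term: it extends the coordinates by zero off the layer without a
    membership proof. *)
Definition fun_of_row d (v : 'rV[R]_#|layer n d|) (S : {set 'I_n}) : R :=
  \sum_(i | enum_val i == S) v 0 i.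

Lemma fun_of_rowK d (v : 'rV[R]_#|layer n d|) : row_of d (fun_of_row v) = v.
Proof.
apply/rowP => i; rewrite mxE /fun_of_row (big_pred1 i) // => j /=.
by rewrite (inj_eq enum_val_inj).
Qed.

Definition fun_of_col d (f : 'cV[R]_#|layer n d|) (S : {set 'I_n}) : R :=
  \sum_(i | enum_val i == S) f i 0.

Lemma fun_of_colK d (f : 'cV[R]_#|layer n d|) : col_of d (fun_of_col f) = f.
Proof.
apply/colP => i; rewrite mxE /fun_of_col (big_pred1 i) // => j /=.
by rewrite (inj_eq enum_val_inj).
Qed.

Lemma row_of_up d g a :
  row_of d g *m up d a = row_of d.+1 (fun T => \sum_(x in T) g (T :\ x) * a x).
Proof.
apply/rowP => j; rewrite !mxE.
under eq_bigr => i _ do rewrite !mxE mulr_sumr.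
set T := enum_val j.
rewrite (exchange_big_dep (mem T)) /=; last by move=> i x _ /andP[].
apply: eq_bigr => x xT.
have TxL : T :\ x \in layer n d by apply: layer_setD1 xT; apply: enum_valP.
rewrite (big_pred1 (enum_rank_in TxL (T :\ x))) ?enum_rankK_in // => i /=.
rewrite xT /=; apply/eqP/eqP => [e|->]; last by rewrite enum_rankK_in.
by apply: enum_val_inj; rewrite enum_rankK_in.
Qed.

Lemma up_col_of d g a :
  up d a *m col_of d.+1 g =
  col_of d (fun S => \sum_(x | x \notin S) a x * g (x |: S)).
Proof.
apply/colP => i; rewrite !mxE.
under eq_bigr => j _ do rewrite !mxE mulr_suml.
set S := enum_val i.
rewrite (exchange_big_dep (fun x => x \notin S)) /=; last first.
  by move=> j x _ /andP[_ /eqP <-]; rewrite setD11.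
apply: eq_bigr => x xS.
have TL : x |: S \in layer n d.+1.
  by apply: layer_setU1 xS; apply: enum_valP.
rewrite (big_pred1 (enum_rank_in TL (x |: S))) ?enum_rankK_in // => j /=.
apply/andP/eqP => [[xT /eqP e]|->].
  by apply: enum_val_inj; rewrite enum_rankK_in // -e setD1K.
by rewrite enum_rankK_in // setU11 setU1K.
Qed.

Lemma upD d a b : up d (fun x => a x + b x) = up d a + up d b.
Proof. by apply/matrixP => i j; rewrite !mxE /= big_split. Qed.

Lemma eq_up d a b : a =1 b -> up d a = up d b.
Proof. by move=> e; apply/matrixP => i j; rewrite !mxE /=; apply: eq_bigr. Qed.

(** Both products sum over ordered pairs of distinct elements removed from a set; exchanging the
    sums swaps the two roles. *)
Lemma up_comm d (a b : 'I_n -> R) : (forall x y, GRing.comm (a x) (b y)) ->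
  up d a *m up d.+1 b = up d b *m up d.+1 a.
Proof.
move=> ab; apply/row_matrixP => i; rewrite !rowE !mulmxA.
rewrite -[delta_mx _ _]fun_of_rowK; set g := fun_of_row _.
rewrite !row_of_up; apply/rowP => j; rewrite !mxE.
set T := enum_val j.
under eq_bigr => x xT do rewrite mulr_suml.
under [RHS]eq_bigr => x xT do rewrite mulr_suml.
rewrite (exchange_big_dep (mem T)) /=; last by move=> x y _; rewrite !inE => /andP[].
apply: eq_bigr => y yT; apply: eq_big => [x|x]; rewrite !inE.
  by rewrite yT andbT eq_sym andbC.
by move=> _; rewrite -!mulrA ab !setDDl setUC.
Qed.

End Up.

Section UpFree.
Variables (K : fieldType) (K_char0 : [pchar K] =i pred0).

Lemma natr_eq0 m : (m%:R == 0 :> K) = (m == 0)%N.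
Proof. by move/pcharf0P: K_char0 => ->. Qed.

(* The weights are chosen so that the matrix with entries
   [w #|T :&: S|] is, up to a factor, a right inverse of [up d 1]. *)
Lemma row_free_up1 n d : (d.*2 < n)%N -> row_free (up d (fun _ : 'I_n => 1 : K)).
Proof.
move=> ltdn.
(* With [e = d - j] the recursion says [(d - j) * w j.+1 + (n - d - (d - j)) * w j = 0], which is
   the vanishing of an off-diagonal entry. The denominators are nonzero since [e <= d] and
   [d.*2 < n]. *)
pose fix v e : K := if e is e'.+1 then - (e'.+1%:R / (n - d - e'.+1)%:R) * v e' else 1.
pose w j := v (d - j)%N.
pose W : 'M[K]_(#|layer n d.+1|, #|layer n d|) :=
  \matrix_(j, i) w #|(enum_val j : {set 'I_n}) :&: enum_val i|.
apply/row_freeP; exists ((n - d)%:R^-1 *: W).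
rewrite -scalemxAr; apply/(canLR (scalerK _)).
  by rewrite natr_eq0; lia.
rewrite scalemx1.
apply/matrixP => i' i; rewrite [RHS]mxE.
set S' : {set 'I_n} := enum_val i'; set S : {set 'I_n} := enum_val i.
have cS' : #|S'| = d by apply: card_enum_val_layer.
have cS : #|S| = d by apply: card_enum_val_layer.
have -> : (up d (fun=> 1) *m W) i' i =
    (up d (fun=> 1) *m col_of d.+1 (fun T => w #|T :&: S|)) i' 0.
  by rewrite !mxE; apply: eq_bigr => j _; rewrite !mxE.
rewrite up_col_of mxE -/S'.
(* The intersection with [S] grows by one exactly when the added element lies in [S], so the sum
   splits into two constant sums. *)
rewrite (bigID (mem S)) /=.
set j := #|S' :&: S|.
have lejd : (j <= d)%N by rewrite -cS subset_leq_card // subsetIr.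
have cD : #|S :\: S'| = (d - j)%N by rewrite cardsD cS setIC.
have cC : #|~: (S' :|: S)| = (n - d - (d - j))%N.
  by have := cardsC (S' :|: S); rewrite cardsU card_ord cS cS' -/j; lia.
rewrite [X in X + _](_ : _ = w j.+1 *+ (d - j)); last first.
  rewrite -cD -sumr_const; apply: eq_big => [x|x /andP[xS' xS]]; first by rewrite inE.
  by rewrite mul1r setIUl (setIidPl _) ?sub1set // cardsU1 inE (negPf xS').
rewrite [X in _ + X](_ : _ = w j *+ (n - d - (d - j))); last first.
  rewrite -cC -sumr_const; apply: eq_big => [x|x /andP[xS' xS]].
    by rewrite !inE negb_or.
  rewrite mul1r setIUl (_ : [set x] :&: S = set0) ?set0U //.
  by apply/setP => y; rewrite !inE; case: eqP => // ->; rewrite (negPf xS).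
have [eqi|neqi] := eqVneq i' i.
  have -> : j = d by rewrite /j /S' eqi setIid.
  by rewrite /w subnn mulr0n add0r subn0.
have ltjd : (j < d)%N.
  rewrite ltn_neqAle lejd andbT; apply: contraNneq neqi => jd.
  apply/eqP/enum_val_inj/eqP; rewrite -/S -/S' eqEcard cS cS' leqnn andbT.
  by apply/setIidPl/eqP; rewrite eqEcard subsetIl cS' -/j jd leqnn.
rewrite /w; case e : (d - j)%N => [|e']; first by lia.
have -> : (d - j.+1)%N = e' by lia.
set m := (n - d - e'.+1)%N; rewrite /= -/m mulr0n.
rewrite -[v e' *+ _]mulr_natr -[_ * v e' *+ m]mulr_natr.
have m0 : m%:R != 0 :> K by rewrite natr_eq0 /m; lia.
by field.
Qed.

End UpFree.

(** * Ranks of pencils *)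

Section Rank.
Variable K : fieldType.

Lemma mxrank_col_mx_coker (m1 m2 n : nat) (X : 'M[K]_(m1, n)) (U : 'M[K]_(m2, n)) :
  \rank (col_mx X U) = (\rank X + \rank (U *m cokermx X))%N.
Proof.
rewrite -addsmxE -(mxrank_mul_ker _ (cokermx X)) addnC; congr addn.
  apply/eqmx_rank/andP; split.
    by apply: submx_trans (capmxSr _ _) _; rewrite submxE mulmx_ker.
  by rewrite sub_capmx addsmxSl sub_kermx mulmx_coker eqxx.
by rewrite addsmxMr mulmx_coker adds0mx.
Qed.

(* The kernel of [v |-> v *m U] modulo the row space of [X] is the row space
   of [kermx (U *m cokermx X)]. *)
Lemma kermx_coker_sub (m1 m2 n p : nat) (X : 'M[K]_(m1, n)) (U : 'M[K]_(m2, n))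
    (Y : 'M[K]_(p, m2)) : (Y *m U <= X)%MS ->
  (\rank X + m2 <= \rank (col_mx X U) + \rank Y)%N =
  (kermx (U *m cokermx X) <= Y)%MS.
Proof.
move=> YU; have YK : (Y <= kermx (U *m cokermx X))%MS.
  by rewrite sub_kermx mulmxA -submxE.
rewrite -(geq_leqif (mxrank_leqif_sup YK)) mxrank_ker mxrank_col_mx_coker.
by have := rank_leq_row (U *m cokermx X); lia.
Qed.

(* If [C *m A *m D = 1], then the determinant of [C *m (A + 'X *: B) *m D]
   takes the value [1] at [0]. *)
Lemma mxrank_generic (m n : nat) (A B : 'M[K]_(m, n)) :
  exists2 p : {poly K}, p != 0 &
    forall t, ~~ root p t -> (\rank A <= \rank (A + t *: B)%R)%N.
Proof.
have /row_fullP[C CA] : row_full (col_base A) by apply: col_base_full.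
have /row_freeP[D AD] : row_free (row_base A) by apply: row_base_free.
have CAD : C *m A *m D = 1%:M.
  have : C *m (col_base A *m row_base A) *m D = 1%:M by rewrite mulmxA CA mul1mx.
  by rewrite mulmx_base.
pose M := C *m B *m D.
exists (\det (1%:M + 'X *: map_mx polyC M)) => [|t].
  apply/eqP => /(congr1 (horner_eval 0)).
  rewrite -det_map_mx map_mxD map_mx1 linear0.
  rewrite (_ : map_mx _ _ = 0) ?addr0 ?det1; first by move/eqP; rewrite oner_eq0.
  by apply/matrixP => i j; rewrite !mxE /= /horner_eval hornerM hornerX mul0r.
rewrite rootE -[_.[t]]/(horner_eval t _) -det_map_mx => dt.
have /mxrank_unit : map_mx (horner_eval t) (1%:M + 'X *: map_mx polyC M) \in unitmx.
  by rewrite unitmxE unitfE.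
rewrite (_ : map_mx _ _ = C *m (A + t *: B) *m D).
  move/eqP; rewrite eqn_leq => /andP[_ /leq_trans]; apply.
  exact: leq_trans (mxrankM_maxl _ _) (mxrankM_maxr _ _).
rewrite mulmxDr mulmxDl CAD -scalemxAr -scalemxAl map_mxD map_mx1; congr (_ + _).
apply/matrixP => i j; rewrite [in LHS]mxE [in LHS]mxE /= /horner_eval hornerM hornerX.
by rewrite [in RHS]mxE [X in X.[t]]mxE hornerC.
Qed.

(** [R] embeds the right null space of [M] into a space of dimension [m2]. *)
Lemma row_full_col_mx_rank (m1 m2 n : nat) (M : 'M[K]_(m1, n)) (R : 'M[K]_(m2, n)) :
  (forall f : 'cV[K]_n, M *m f = 0 -> R *m f = 0 -> f = 0) ->
  (n <= \rank M + m2)%N.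
Proof.
move=> MR0; have : row_full (col_mx M R).
  rewrite -cokermx_eq0; apply/eqP; set Q := cokermx _.
  have /eqP := mulmx_coker (col_mx M R); rewrite mul_col_mx col_mx_eq0 -/Q.
  case/andP => /eqP MQ0 /eqP RQ0; apply/matrixP => i j.
  have /colP/(_ i) : col j Q = 0 by apply: MR0; rewrite colE mulmxA ?MQ0 ?RQ0 mul0mx.
  by rewrite !mxE.
rewrite /row_full -addsmxE eqn_leq => /andP[_ /leq_trans]; apply.
apply: leq_trans (mxrank_adds_leqif _ _) _.
by rewrite leq_add2l rank_leq_row.
Qed.

(* The cokernel of [pencil d a] is degree [d.+1] of the squarefree algebra
   modulo the two linear forms with coefficients [1] and [a]. *)
Definition pencil (n d : nat) (a : 'I_n -> K) :
    'M[K]_(#|layer n d| + #|layer n d|, #|layer n d.+1|) :=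
  col_mx (up d (fun=> 1)) (up d a).

End Rank.

(** * Semicontinuity of the rank of the pencil *)

Section MaxRank.
Variables (K : closedFieldType) (K_char0 : [pchar K] =i pred0).
Variables (n d : nat).

Lemma up_scale (t : K) (a : 'I_n -> K) : up d (fun x => t * a x) = t *: up d a.
Proof. by apply/matrixP => i j; rewrite !mxE /= mulr_sumr. Qed.

(** Move from [a] along a line whose direction has distinct coordinates: for all but finitely many
    [t] the rank does not drop and the coordinates are distinct. An algebraically closed field
    contains such a [t]. *)
Lemma rank_pencil_semicont (rho : nat) :
  (forall a : 'I_n -> K, injective a -> (\rank (pencil d a) <= rho)%N) ->
  forall a : 'I_n -> K, (\rank (pencil d a) <= rho)%N.
Proof.
move=> le_rho a.
pose b (x : 'I_n) : K := x%:R.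
have [p p0 pP] := mxrank_generic (pencil d a) (col_mx 0 (up d b)).
pose q := \prod_(xy : 'I_n * 'I_n | xy.1 != xy.2)
  ((a xy.1 - a xy.2)%:P + 'X * (b xy.1 - b xy.2)%:P).
have b_inj : injective b.
  move=> x y /eqP; rewrite /b; case: (leqP x y) => [xy|/ltnW xy].
    rewrite eq_sym -subr_eq0 -natrB // natr_eq0 // subn_eq0 => yx.
    by apply/val_inj/eqP; rewrite eqn_leq xy.
  rewrite -subr_eq0 -natrB // natr_eq0 // subn_eq0 => yx.
  by apply/val_inj/eqP; rewrite eqn_leq xy andbT.
have q0 : q != 0.
  apply/prodf_neq0 => -[x y] /= xy; apply/eqP => /(congr1 (fun r : {poly K} => r`_1)).
  rewrite coefD coefXM coefC coef0 /= add0r coefC /= => /eqP.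
  by rewrite subr_eq0 (inj_eq b_inj) (negPf xy).
have /closed_nonrootP[t] : p * q != 0 by rewrite mulf_neq0.
rewrite rootM negb_or => /andP[pt qt].
apply: leq_trans (pP t pt) _.
have -> : pencil d a + t *: col_mx 0 (up d b) = pencil d (fun x => a x + t * b x).
  by rewrite scale_col_mx scaler0 add_col_mx addr0 /pencil upD up_scale.
apply: le_rho => x y /eqP exy; apply/eqP; apply: contraNT qt => xy.
rewrite /q (bigD1 (x, y)) //= rootM; apply/orP; left.
rewrite rootE !hornerE; apply/eqP.
by move: exy; rewrite -subr_eq0 => /eqP <-; ring.
Qed.

End MaxRank.

(** * The quotient by squares of linear forms *)

Section Squarefree.
Variables (K : fieldType) (n : nat).
Implicit Types (T : {set 'I_n}) (q : {mpoly K[n]}) (a : 'I_n -> K).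

Definition mset T : 'X_{1..n} := [multinom (i \in T : nat) | i < n].

(** These coefficients determine the class of [q] modulo the squares of the variables. *)
Definition sqfree q T : K := q@_(mset T).

Lemma msetE T i : mset T i = (i \in T).
Proof. exact: mnmE. Qed.

Lemma mset_inj : injective mset.
Proof.
move=> S T e; apply/setP => i.
by have := congr1 (fun m : 'X_{1..n} => m i) e; rewrite !msetE; do 2!case: (i \in _).
Qed.

Lemma mdeg_mset T : mdeg (mset T) = #|T|.
Proof.
rewrite mdegE -sum1_card [RHS]big_mkcond /=.
by apply: eq_bigr => i _; rewrite msetE; case: (i \in T).
Qed.

Lemma mcoeffMX_eq0 q (m k : 'X_{1..n}) (i : 'I_n) : (k i < m i)%N -> (q * 'X_[m])@_k = 0.
Proof.
move=> lt_km; apply: memN_msupp_eq0; rewrite (perm_mem (msuppMX _ _)).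
apply: contraTN lt_km => /mapP[k' _ ->].
by rewrite mnmDE -leqNgt leq_addr.
Qed.

Lemma sqfreeMX q x T :
  sqfree (q * 'X_x) T = if x \in T then sqfree q (T :\ x) else 0.
Proof.
case: ifP => xT; last first.
  by apply: (@mcoeffMX_eq0 _ _ _ x); rewrite msetE xT mnm1E eqxx.
rewrite /sqfree (_ : mset T = (U_(x) + mset (T :\ x))%MM) ?mcoeffMX //.
apply/mnmP => i; rewrite mnmDE !msetE mnm1E !inE eq_sym.
by case: eqVneq => [->|]; rewrite ?xT.
Qed.

Lemma sqfreeMXX q x T : sqfree (q * 'X_x ^+ 2) T = 0.
Proof.
rewrite mpolyXn; apply: (@mcoeffMX_eq0 _ _ _ x).
by rewrite msetE mulmnE mnm1E eqxx; case: (x \in T).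
Qed.

Lemma sqfreeZ c q T : sqfree (c *: q) T = c * sqfree q T.
Proof. exact: mcoeffZ. Qed.

Lemma sqfree_sum (J : finType) (F : J -> {mpoly K[n]}) T :
  sqfree (\sum_j F j) T = \sum_j sqfree (F j) T.
Proof. exact: raddf_sum. Qed.

Definition linform a : {mpoly K[n]} := \sum_x a x *: 'X_x.

Lemma sqfree_linform q a T :
  sqfree (q * linform a) T = \sum_(x in T) sqfree q (T :\ x) * a x.
Proof.
rewrite mulr_sumr sqfree_sum [RHS]big_mkcond /=; apply: eq_bigr => x _.
rewrite -scalerAr sqfreeZ sqfreeMX mulrC.
by case: ifP => // _; rewrite mul0r.
Qed.

Lemma row_of_linform d q a :
  row_of d.+1 (sqfree (q * linform a)) = row_of d (sqfree q) *m up d a.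
Proof.
by rewrite row_of_up; apply/rowP => i; rewrite !mxE sqfree_linform.
Qed.

Lemma row_of_sqfreeD d p q :
  row_of d (sqfree (p + q)) = row_of d (sqfree p) + row_of d (sqfree q).
Proof. by apply/rowP => i; rewrite !mxE /sqfree mcoeffD. Qed.

Lemma row_of_sqfree_sum d (J : finType) (F : J -> {mpoly K[n]}) :
  row_of d (sqfree (\sum_j F j)) = \sum_j row_of d (sqfree (F j)).
Proof.
apply/rowP => i; rewrite mxE sqfree_sum summxE.
by apply: eq_bigr => j _; rewrite mxE.
Qed.

Definition sqmonom (S : {set 'I_n}) : {mpoly K[n]} := \prod_(x in S) 'X_x.

Lemma sqfree_prodX (S T : {set 'I_n}) : sqfree (sqmonom S) T = (S == T)%:R.
Proof.
have -> : sqmonom S = 'X_[mset S].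
  rewrite /sqmonom mpolyXE_id [LHS]big_mkcond /=; apply: eq_bigr => x _.
  by rewrite msetE; case: (x \in S).
by rewrite /sqfree mcoeffX (inj_eq mset_inj).
Qed.

Definition poly_of_row d (v : 'rV[K]_#|layer n d|) : {mpoly K[n]} :=
  \sum_i v 0 i *: sqmonom (enum_val i).

Lemma poly_of_rowK d (v : 'rV[K]_#|layer n d|) :
  row_of d (sqfree (poly_of_row v)) = v.
Proof.
apply/rowP => i; rewrite mxE sqfree_sum (bigD1 i) //= big1 ?addr0.
  by rewrite sqfreeZ sqfree_prodX eqxx mulr1.
move=> j ji; rewrite sqfreeZ sqfree_prodX.
by rewrite (inj_eq enum_val_inj) (negPf ji) mulr0.
Qed.

Lemma dhomog_prod_exp (J : finType) (F : J -> {mpoly K[n]}) (e : J -> nat) :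
  (forall j, F j \is 1.-homog) -> \prod_j F j ^+ e j \is (\sum_j e j).-homog.
Proof.
move=> F1; elim/big_ind2: _ => [|p1 d1 p2 d2|j _]; first exact: dhomog1.
  exact: dhomogM.
by have := dhomogMn (e j) (F1 j); rewrite mul1n.
Qed.

Lemma poly_of_row_homog d (v : 'rV[K]_#|layer n d|) : poly_of_row v \is d.-homog.
Proof.
apply: rpred_sum => i _; apply: rpredZ.
suff : sqmonom (enum_val i) \is (mdeg (mset (enum_val i))).-homog.
  by rewrite mdeg_mset card_enum_val_layer.
rewrite /sqmonom big_mkcond /= mdegE.
rewrite (eq_bigr (fun x : 'I_n => 'X_x ^+ mset (enum_val i) x)) => [|x _].
  by apply: dhomog_prod_exp => x; rewrite dhomogX /= mdeg1.
by rewrite msetE; case: (x \in _).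
Qed.

Lemma mcoeff_linform a x : (linform a)@_U_(x) = a x.
Proof.
rewrite raddf_sum (bigD1 x) //= mcoeffZ mcoeffXU eqxx mulr1 big1 ?addr0 // => y yx.
by rewrite mcoeffZ mcoeffXU (negPf yx) mulr0.
Qed.

Lemma dhomog1_linform q : q \is 1.-homog -> q = linform (fun x => q@_U_(x)).
Proof.
move=> q1; apply/mpolyP => m; rewrite raddf_sum /=.
under eq_bigr => x _ do rewrite mcoeffZ mcoeffX.
have [/mdeg1P[y /eqP ->]|m1] := boolP (mdeg m == 1%N).
  rewrite (bigD1 y) //= eqxx mulr1 big1 ?addr0 // => x xy.
  by rewrite eq_mnm1 (negPf xy) mulr0.
rewrite (dhomog_nemf_coeff q1) // big1 // => x _.
have /negPf-> : U_(x)%MM != m by apply: contraNneq m1 => <-; rewrite mdeg1.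
by rewrite mulr0.
Qed.

Lemma linform_homog a : linform a \is 1.-homog.
Proof.
by apply: rpred_sum => x _; apply: rpredZ; rewrite dhomogX /= mdeg1.
Qed.

End Squarefree.

Lemma mulmx_scale_sum (K : fieldType) (V : lmodType K) (m p q : nat)
    (A : 'M[K]_(m, p)) (C : 'M[K]_(p, q)) (F : 'I_q -> V) i :
  \sum_k A i k *: (\sum_j C k j *: F j) = \sum_j (A *m C) i j *: F j.
Proof.
under eq_bigr => k _ do rewrite scaler_sumr.
rewrite exchange_big /=; apply: eq_bigr => j _; rewrite mxE scaler_suml.
by apply: eq_bigr => k _; rewrite scalerA.
Qed.

Lemma scalar1_scale_sum (K : fieldType) (V : lmodType K) (q : nat)
    (F : 'I_q -> V) i : \sum_j (1%:M : 'M[K]_q) i j *: F j = F i.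
Proof.
rewrite (bigD1 i) //= mxE eqxx scale1r big1 ?addr0 // => j ji.
by rewrite mxE eq_sym (negPf ji) scale0r.
Qed.

(** * The presentation by [r.+1] squares and one linear relation *)

Section Presentation.
Variables (K : fieldType) (r : nat) (I : idealr {mpoly K[r]}).
Variable b : 'I_r.+1 -> {mpoly K[r]}.
Hypothesis b_homog : forall i, b i \is 1.-homog.
Hypothesis sum_b : \sum_i b i = 0.
Hypothesis I_gen : forall p : {mpoly K[r]},
  p \in I <-> exists g : 'I_r.+1 -> {mpoly K[r]}, p = \sum_i g i * b i ^+ 2.
Let B : 'M[K]_r := \matrix_(j, k) (b (lift ord0 j))@_U_(k).
Hypothesis B_unit : B \in unitmx.

Let sigma : {mpoly K[r.+1]} := linform (fun=> 1).

(* [R / I] is [K['X_0, ..., 'X_r] / ('X_0 ^+ 2, ..., 'X_r ^+ 2, sigma)] via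
   ['X_i |-> b i]; the section [to_polys] of this map avoids ['X_0]. *)
Definition to_polys : {mpoly K[r]} -> {mpoly K[r.+1]} :=
  mmap (@mpolyC r.+1 K) (fun k => \sum_j invmx B k j *: 'X_(lift ord0 j)).

Definition from_polys : {mpoly K[r.+1]} -> {mpoly K[r]} :=
  mmap (@mpolyC r K) b.

HB.instance Definition _ := GRing.RMorphism.on to_polys.
HB.instance Definition _ := GRing.RMorphism.on from_polys.

Lemma to_polysX k : to_polys 'X_k = \sum_j invmx B k j *: 'X_(lift ord0 j).
Proof. by rewrite /to_polys mmapX mmap1U. Qed.

Lemma to_polysZ c p : to_polys (c *: p) = c *: to_polys p.
Proof. by rewrite /to_polys mmapZ mul_mpolyC. Qed.

Lemma from_polysX i : from_polys 'X_i = b i.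
Proof. by rewrite /from_polys mmapX mmap1U. Qed.

Lemma from_polysZ c p : from_polys (c *: p) = c *: from_polys p.
Proof. by rewrite /from_polys mmapZ mul_mpolyC. Qed.

Lemma b_lift j : b (lift ord0 j) = \sum_k B j k *: 'X_k.
Proof.
rewrite {1}[b _]dhomog1_linform //; apply: eq_bigr => k _.
by rewrite mxE.
Qed.

Lemma to_polys_lift j : to_polys (b (lift ord0 j)) = 'X_(lift ord0 j).
Proof.
rewrite b_lift raddf_sum /=.
under eq_bigr => k _ do rewrite to_polysZ to_polysX.
by rewrite mulmx_scale_sum mulmxV // scalar1_scale_sum.
Qed.

Lemma to_polys0 : to_polys (b ord0) = 'X_ord0 - sigma.
Proof.
move: sum_b; rewrite big_ord_recl => /eqP; rewrite addr_eq0 => /eqP ->.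
rewrite (rmorphN to_polys) (rmorph_sum to_polys) /sigma /linform big_ord_recl.
rewrite scale1r opprD addrA subrr add0r; congr (- _).
by apply: eq_bigr => j _; rewrite scale1r; apply: to_polys_lift.
Qed.

Lemma to_polys_b x : to_polys (b x) = 'X_x - (x == ord0)%:R *: sigma.
Proof.
case: (unliftP ord0 x) => [j|] ->; last by rewrite eqxx scale1r to_polys0.
by rewrite scale0r subr0 to_polys_lift.
Qed.

Lemma from_to_polys p : from_polys (to_polys p) = p.
Proof.
have X k : from_polys (to_polys 'X_k) = 'X_k.
  rewrite to_polysX raddf_sum /=.
  under eq_bigr => j _ do rewrite from_polysZ from_polysX b_lift.
  by rewrite mulmx_scale_sum mulVmx // scalar1_scale_sum.
rewrite {1}[p]mpolyE [RHS]mpolyE (rmorph_sum to_polys) (rmorph_sum from_polys).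
apply: eq_bigr => m _ /=; rewrite to_polysZ from_polysZ; congr (_ *: _).
rewrite mpolyXE_id (rmorph_prod to_polys) (rmorph_prod from_polys).
by apply: eq_bigr => k _; rewrite (rmorphXn to_polys) (rmorphXn from_polys) /= X.
Qed.

(** [sqrow] and [of_row] pass between forms modulo [I] and row vectors modulo multiples of [sigma];
    they are inverse to each other only modulo these. *)
Definition sqrow d (p : {mpoly K[r]}) := row_of d (sqfree (to_polys p)).

Definition of_row d (v : 'rV[K]_#|layer r.+1 d|) : {mpoly K[r]} :=
  from_polys (poly_of_row v).

Lemma sqrow_ideal d p : p \in I -> (sqrow d.+1 p <= up d (fun=> 1))%MS.
Proof.
case/I_gen => g ->; rewrite /sqrow raddf_sum /= row_of_sqfree_sum.
apply: summx_sub => x _; rewrite rmorphM rmorphXn /= to_polys_b.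
set e := _%:R; set q := to_polys (g x).
(* The term in ['X_x ^+ 2] has no squarefree part, and the rest of the expanded square is a multiple
   of [sigma]. *)
rewrite (_ : q * _ = q * 'X_x ^+ 2 + (q * (e *: (e *: sigma - 2 *: 'X_x))) * sigma).
  rewrite row_of_sqfreeD row_of_linform (_ : row_of _ _ = 0) ?add0r ?submxMl //.
  by apply/rowP => i; rewrite !mxE sqfreeMXX.
by rewrite -!mul_mpolyC; ring.
Qed.

Lemma idealrMl (u v : {mpoly K[r]}) : v \in I -> u * v \in I.
Proof.
case/I_gen => g ->; apply/I_gen; exists (fun i => u * g i).
by rewrite mulr_sumr; apply: eq_bigr => i _; rewrite mulrA.
Qed.

Lemma b2_ideal x : b x ^+ 2 \in I.
Proof.
apply/I_gen; exists (fun i => (i == x)%:R).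
rewrite (bigD1 x) //= eqxx mul1r big1 ?addr0 // => i /negPf ->.
by rewrite mul0r.
Qed.

Lemma from_polys_nonsqfree (m : 'X_{1..r.+1}) x : (1 < m x)%N -> from_polys 'X_[m] \in I.
Proof.
move=> mx; rewrite mpolyXE_id (bigD1 x) //= rmorphM rmorphXn /= from_polysX.
by rewrite -(subnK mx) exprD mulrAC; apply/idealrMl/b2_ideal.
Qed.

Lemma to_polys_homog d p : p \is d.-homog -> to_polys p \is d.-homog.
Proof.
move/dhomogP => pd; rewrite [p]mpolyE (rmorph_sum to_polys) big_seq.
apply: rpred_sum => m /pd md; rewrite /= to_polysZ; apply: rpredZ.
rewrite mpolyXE_id (rmorph_prod to_polys) -md /= mdegE.
rewrite (eq_bigr (fun k => to_polys 'X_k ^+ m k)) => [|k _]; last exact: rmorphXn.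
apply: dhomog_prod_exp => k; rewrite to_polysX.
by apply: rpred_sum => j _; apply: rpredZ; rewrite dhomogX /= mdeg1.
Qed.

Lemma from_polys_homog d q : q \is d.-homog -> from_polys q \is d.-homog.
Proof.
move/dhomogP => qd; rewrite [q]mpolyE (rmorph_sum from_polys) big_seq.
apply: rpred_sum => m /qd md; rewrite /= from_polysZ; apply: rpredZ.
rewrite mpolyXE_id (rmorph_prod from_polys) -md /= mdegE.
rewrite (eq_bigr (fun k => b k ^+ m k)) => [|k _]; last first.
  by rewrite (rmorphXn from_polys) /= from_polysX.
exact: dhomog_prod_exp.
Qed.

(** Once the squarefree part is removed, every remaining monomial has an exponent at least 2, so its
    image is a multiple of some [b x ^+ 2]. *)
Lemma from_polys_mod d q : q \is d.-homog ->
  from_polys q - of_row (row_of d (sqfree q)) \in I.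
Proof.
move=> qd; rewrite -(rmorphB from_polys); set q' := q - _.
have q'd : q' \is d.-homog by rewrite rpredB ?poly_of_row_homog.
have sq'0 T : sqfree q' T = 0.
  have [cT|cT] := eqVneq #|T| d; last first.
    by apply: dhomog_nemf_coeff q'd _; rewrite /= mdeg_mset.
  have TL : T \in layer r.+1 d by rewrite in_layer cT.
  suff /rowP/(_ (enum_rank_in TL T)) : row_of d (sqfree q') = 0.
    by rewrite !mxE enum_rankK_in.
  apply/rowP => i; have := poly_of_rowK (row_of d (sqfree q)).
  by move/rowP/(_ i); rewrite !mxE /sqfree mcoeffB => ->; rewrite subrr.
rewrite [q']mpolyE (rmorph_sum from_polys) big_seq; apply: rpred_sum => m mq'.
rewrite /= from_polysZ -mul_mpolyC; apply: idealrMl.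
have [/existsP[x mx]|] := boolP [exists x, (1 < m x)%N].
  exact: from_polys_nonsqfree mx.
rewrite negb_exists => /forallP m1.
have me : m = mset [set x | m x != 0%N].
  apply/mnmP => x; rewrite msetE inE.
  by have := m1 x; case: (m x) => [|[|]].
by move: mq'; rewrite mcoeff_msupp me -/(sqfree q' _) sq'0 eqxx.
Qed.

Lemma of_row_sqrow d p : p \is d.-homog -> p - of_row (sqrow d p) \in I.
Proof.
by move=> pd; rewrite -{1}(from_to_polys p) from_polys_mod ?to_polys_homog.
Qed.

Lemma from_polys_linform a : from_polys (linform a) = \sum_x a x *: b x.
Proof.
rewrite (rmorph_sum from_polys); apply: eq_bigr => x _.
by rewrite /= from_polysZ from_polysX.
Qed.

Lemma of_row_up d (v : 'rV[K]_#|layer r.+1 d|) a :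
  (\sum_x a x *: b x) * of_row v - of_row (v *m up d a) \in I.
Proof.
rewrite -from_polys_linform -(rmorphM from_polys) mulrC.
rewrite -{2}(poly_of_rowK v) -row_of_linform; apply: from_polys_mod.
by have := dhomogM (poly_of_row_homog v) (linform_homog a); rewrite addn1.
Qed.

Lemma sqrow_of_row d (v : 'rV[K]_#|layer r.+1 d.+1|) :
  (sqrow d.+1 (of_row v) - v <= up d (fun=> 1))%MS.
Proof.
(* [to_polys] after [from_polys] fixes every variable modulo [sigma], hence every polynomial. *)
have [Q eQ] : exists Q, to_polys (of_row v) = poly_of_row v + Q * sigma.
  rewrite /of_row /poly_of_row (rmorph_sum from_polys) (rmorph_sum to_polys) /=.
  elim/big_ind2: _ => [|p1 q1 p2 q2 [Q1 ->] [Q2 ->]|i _].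
  - by exists 0; rewrite mul0r addr0.
  - by exists (Q1 + Q2); ring.
  rewrite from_polysZ to_polysZ.
  have [Q ->] : exists Q, to_polys (from_polys (sqmonom K (enum_val i)))
      = sqmonom K (enum_val i) + Q * sigma.
    rewrite /sqmonom (rmorph_prod from_polys) (rmorph_prod to_polys) /=.
    elim/big_ind2: _ => [|p1 q1 p2 q2 [Q1 ->] [Q2 ->]|x _].
    - by exists 0; rewrite mul0r addr0.
    - by exists (Q1 * p2 + p1 * Q2 + Q1 * Q2 * sigma); ring.
    exists (- (x == ord0)%:R%:MP); rewrite from_polysX to_polys_b.
    by rewrite mulNr mul_mpolyC.
  by exists (v 0 i *: Q); rewrite scalerDr scalerAl.
rewrite /sqrow eQ row_of_sqfreeD poly_of_rowK row_of_linform addrC addKr.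
exact: submxMl.
Qed.

Notation Q := {ideal_quot I}.
Local Open Scope quotient_scope.

Lemma pi_eq (p q : {mpoly K[r]}) : \pi_Q p = \pi_Q q <-> p - q \in I.
Proof.
by rewrite Quotient.idealrBE; split=> [/eqP|/eqP].
Qed.

Definition lform (a : 'I_r.+1 -> K) : {mpoly K[r]} := \sum_x a x *: b x.

Lemma lform_homog a : lform a \is 1.-homog.
Proof. by apply: rpred_sum => x _; apply/rpredZ/b_homog. Qed.

Lemma dhomog1_lform p : p \is 1.-homog -> exists a, p = lform a.
Proof.
move=> /to_polys_homog/dhomog1_linform e.
exists (fun x => (to_polys p)@_U_(x)).
by rewrite -{1}(from_to_polys p) {1}e from_polys_linform.
Qed.

Lemma of_row_homog d (v : 'rV[K]_#|layer r.+1 d|) : of_row v \is d.-homog.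
Proof. exact/from_polys_homog/poly_of_row_homog. Qed.

Lemma sqrowB d p q : sqrow d (p - q) = sqrow d p - sqrow d q.
Proof. by apply/rowP => i; rewrite !mxE (rmorphB to_polys) /sqfree mcoeffB. Qed.

Lemma of_row_up1 d (v : 'rV[K]_#|layer r.+1 d|) : of_row (v *m up d (fun=> 1)) \in I.
Proof.
have := of_row_up v (fun=> 1).
under eq_bigr => x _ do rewrite scale1r.
by rewrite sum_b mul0r sub0r rpredN.
Qed.

Lemma of_rowD d (u v : 'rV[K]_#|layer r.+1 d|) : of_row (u + v) = of_row u + of_row v.
Proof.
rewrite /of_row -(rmorphD from_polys) -big_split; congr from_polys.
by apply: eq_bigr => i _; rewrite mxE scalerDl.
Qed.

(** [to_polys] turns [lform a] into [linform a] up to a multiple of [sigma], which only contributes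
    to the row space of [up d (fun=> 1)]. *)
Lemma sqrow_lform d a p :
  (sqrow d.+1 (lform a * p) - sqrow d p *m up d a <= up d (fun=> 1))%MS.
Proof.
have -> : sqrow d.+1 (lform a * p) = sqrow d p *m up d a -
    a ord0 *: (sqrow d p *m up d (fun=> 1)).
  have e : to_polys (lform a) = linform a - a ord0 *: sigma.
    rewrite (rmorph_sum to_polys) /= (bigD1 ord0) //= /linform [in RHS](bigD1 ord0) //=.
    rewrite !to_polysZ to_polys_b eqxx scale1r scalerBr -!addrA; congr (_ + _).
    rewrite addrC; congr (_ + _); apply: eq_bigr => x /negPf x0.
    by rewrite to_polysZ to_polys_b x0 scale0r subr0.
  rewrite /sqrow (rmorphM to_polys) /= e mulrC mulrBr -scalerAr -scaleNr.
  rewrite row_of_sqfreeD row_of_linform -scaleNr; congr (_ + _).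
  rewrite -row_of_linform; apply/rowP => i.
  by rewrite !mxE sqfreeZ.
by rewrite addrC addKr -scaleNr scalemx_sub // submxMl.
Qed.

(** Through [sqrow], degree [d.+1] of the quotient is the space of row vectors modulo the first
    block of the pencil, and the image of the multiplication is spanned by the second block. *)
Lemma surj_row_full d a :
  (forall c : Q, graded_piece d.+1 c ->
     exists2 u : Q, graded_piece d u & \pi_Q (lform a) * u = c)
  <-> row_full (pencil d a).
Proof.
split=> [surj|full].
  rewrite -sub1mx; apply/row_subP => i; set v := row i _.
  case: (surj (\pi_Q (of_row v))); first by exists (of_row v) => //; apply: of_row_homog.
  move=> _ [p pd ->] /esym/eqP; rewrite -rmorphM => /eqP/pi_eq/(sqrow_ideal d).
  rewrite /pencil -addsmxE sqrowB => H1.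
  have H2 := sqrow_of_row v; have H3 := sqrow_lform d a p.
  (* The first three summands lie in the row space of the first block, the last one in that of the
     second. *)
  have -> : v = - (sqrow d.+1 (of_row v) - v)
    + (sqrow d.+1 (of_row v) - sqrow d.+1 (lform a * p))
    + (sqrow d.+1 (lform a * p) - sqrow d p *m up d a) + sqrow d p *m up d a.
    by rewrite opprB !addrA !subrK.
  apply: addmx_sub; last exact: submx_trans (submxMl _ _) (addsmxSr _ _).
  apply: submx_trans (addsmxSl _ _); apply: addmx_sub H3; apply: addmx_sub H1.
  by rewrite -scaleN1r scalemx_sub.
move=> _ [p pd ->].
have /submxP[D eD] := submx_full (sqrow d.+1 p) full.
rewrite -[D]hsubmxK /pencil mul_row_col in eD.
set u := lsubmx D in eD; set w := rsubmx D in eD.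
exists (\pi_Q (of_row w)); first by exists (of_row w) => //; apply: of_row_homog.
rewrite -rmorphM; apply/pi_eq; rewrite -opprB rpredN.
have := of_row_sqrow pd; rewrite eD of_rowD => H.
have -> : p - lform a * of_row w =
  (p - (of_row (u *m up d (fun=> 1)) + of_row (w *m up d a)))
  + of_row (u *m up d (fun=> 1)) - (lform a * of_row w - of_row (w *m up d a)) by ring.
rewrite rpredB ?of_row_up // rpredD ?of_row_up1 //.
Qed.

(** The degree is [d.+1] because multiples of [sigma] come from one degree lower; degree 0 is left
    to [inj0]. *)
Lemma inj_kermx d a :
  (forall u v : Q, graded_piece d.+1 u -> graded_piece d.+1 v ->
     \pi_Q (lform a) * u = \pi_Q (lform a) * v -> u = v)
  <-> (forall v : 'rV[K]_#|layer r.+1 d.+1|,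
        (v *m up d.+1 a <= up d.+1 (fun=> 1) -> v <= up d (fun=> 1))%MS).
Proof.
split=> [inj v /submxP[w ew]|inj _ _ [p pd ->] [q qd ->]].
  have : of_row v \in I.
    rewrite -[of_row v]subr0; apply/pi_eq/inj.
    - by exists (of_row v) => //; apply: of_row_homog.
    - by exists 0 => //; apply: rpred0.
    rewrite -!rmorphM; apply/pi_eq; rewrite mulr0 subr0.
    have := of_row_up v a; rewrite ew => H.
    by rewrite -[X in X \in I](subrK (of_row (w *m up d.+1 (fun=> 1)))) rpredD // of_row_up1.
  move/(sqrow_ideal d) => H; have H2 := sqrow_of_row v.
  have -> : v = sqrow d.+1 (of_row v) - (sqrow d.+1 (of_row v) - v) by rewrite subKr.
  by rewrite addmx_sub // -scaleN1r scalemx_sub.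
rewrite -!rmorphM => /pi_eq; rewrite -mulrBr => H; apply/pi_eq.
have pqd : p - q \is d.+1.-homog by rewrite rpredB.
have {}H := sqrow_ideal d.+1 H.
have /inj/submxP[w ew] : (sqrow d.+1 (p - q) *m up d.+1 a <= up d.+1 (fun=> 1))%MS.
  rewrite -[X in (X <= _)%MS](subKr (sqrow d.+2 (lform a * (p - q)))).
  by rewrite addmx_sub // -scaleN1r scalemx_sub ?sqrow_lform.
rewrite -[p - q](subrK (of_row (sqrow d.+1 (p - q)))) rpredD ?of_row_sqrow //.
by rewrite ew of_row_up1.
Qed.

(** A constant [c] in the kernel makes [c * a z] independent of [z]; comparing [x] with [y] gives
    [c = 0]. *)
Lemma inj0 a x y : a x != a y ->
  forall u v : Q, graded_piece 0 u -> graded_piece 0 v ->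
     \pi_Q (lform a) * u = \pi_Q (lform a) * v -> u = v.
Proof.
move=> axy _ _ [p pd ->] [q qd ->].
rewrite -!rmorphM => /pi_eq; rewrite -mulrBr => H; apply/pi_eq.
have pqd : p - q \is 0.-homog by rewrite rpredB.
have {}H := sqrow_ideal 0 H.
have /submxP[w ew] : (sqrow 0 (p - q) *m up 0 a <= up 0 (fun=> 1))%MS.
  rewrite -[X in (X <= _)%MS](subKr (sqrow 1 (lform a * (p - q)))).
  by rewrite addmx_sub // -scaleN1r scalemx_sub ?sqrow_lform.
suff e0 : sqrow 0 (p - q) = 0.
  have := of_row_sqrow pqd; rewrite e0 (_ : of_row 0 = 0) ?subr0 //.
  rewrite /of_row /poly_of_row big1 ?(rmorph0 from_polys) // => i _.
  by rewrite mxE scale0r.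
set g := sqfree (to_polys (p - q)).
rewrite -(fun_of_rowK w) !row_of_up in ew.
have ew' z : g set0 * a z = fun_of_row w set0.
  have zL : [set z] \in layer r.+1 1 by rewrite in_layer cards1.
  move/rowP/(_ (enum_rank_in zL [set z])): ew.
  by rewrite !mxE enum_rankK_in // !big_set1 setDv mulr1.
have /eqP : g set0 * a x - g set0 * a y = 0 by rewrite !ew' subrr.
rewrite -mulrBr mulf_eq0 subr_eq0 (negPf axy) orbF => /eqP g0.
apply/rowP => i; rewrite !mxE.
suff -> : enum_val i = set0 by [].
by apply/eqP; rewrite -cards_eq0 card_enum_val_layer.
Qed.

Lemma WLPE : has_WLP I <-> exists a, forall d,
  (forall u v : Q, graded_piece d u -> graded_piece d v ->
     \pi_Q (lform a) * u = \pi_Q (lform a) * v -> u = v) \/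
  (forall c : Q, graded_piece d.+1 c ->
     exists2 u : Q, graded_piece d u & \pi_Q (lform a) * u = c).
Proof.
split=> [[_ [p p1 ->] maxr]|[a maxr]].
  by have [a ep] := dhomog1_lform p1; exists a; rewrite -ep.
by exists (\pi_Q (lform a)) => //; exists (lform a) => //; apply: lform_homog.
Qed.

End Presentation.

(** * Products of secant determinants *)

(** By [up_comm] the kernel of [up d.+1 a] modulo [sigma] contains the multiples of [sigma], so
    injectivity is a comparison of dimensions; [row_free_up1] supplies the ranks of multiplication
    by [sigma]. *)
Lemma kermx_up_rank (K : fieldType) (K_char0 : [pchar K] =i pred0) n d
    (a : 'I_n -> K) : (d.+1.*2 < n)%N ->
  (forall v : 'rV[K]_#|layer n d.+1|,
    (v *m up d.+1 a <= up d.+1 (fun=> 1) -> v <= up d (fun=> 1))%MS)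
  <-> (('C(n, d.+1)).*2 <= \rank (pencil d.+1 a) + 'C(n, d))%N.
Proof.
move=> ltdn.
have rk e : (e.*2 < n)%N -> \rank (up e (fun _ : 'I_n => 1 : K)) = 'C(n, e).
  by move=> en; rewrite -card_layer; apply/eqP/row_free_up1.
have YU : (up d (fun=> 1) *m up d.+1 a <= up d.+1 (fun=> 1%R : K))%MS.
  rewrite up_comm ?submxMl // => x y; exact: mulrC.
have := kermx_coker_sub YU; rewrite -/(pencil d.+1 a) !rk //; last by lia.
rewrite [X in (_ + X <= _)%N]card_layer addnn => ->; split=> [inj|sub v vU].
  apply/row_subP => i; apply: inj.
  by rewrite submxE -mulmxA -row_mul mulmx_ker row0.
by apply: submx_trans sub; rewrite sub_kermx mulmxA -submxE.
Qed.

Section Theta.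
Variables (K : fieldType) (n : nat) (a : 'I_n -> K).
Hypothesis a_inj : injective a.
Implicit Types (T U I Z W : {set 'I_n}).

(* The coefficient of [q] in degree [#|W|.-1] is computed by Lagrange
   interpolation on the points [a x], [x \in W]. *)
Lemma lagrange_sum0 W (q : {poly K}) : (size q < #|W|)%N ->
  \sum_(x in W) q.[a x] * \prod_(j in W :\ x) (a x - a j)^-1 = 0.
Proof.
move=> ltqW.
pose c x := q.[a x] * \prod_(j in W :\ x) (a x - a j)^-1.
pose N x := \prod_(j in W :\ x) ('X - (a j)%:P).
have sN x : x \in W -> size (N x) = #|W|.
  by move=> xW; rewrite /N -big_enum size_prod_XsubC -cardE [RHS](cardsD1 x) xW.
have NW x : x \in W -> (N x)`_#|W|.-1 = 1.
  move=> xW; have /monicP : N x \is monic by rewrite /N -big_enum monic_prod_XsubC.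
  by rewrite /lead_coef sN.
(* The sum interpolates [q]: the difference has size at most [#|W|] and vanishes at [#|W|]
   points. *)
have eq : \sum_(x in W) c x *: N x = q.
  apply/eqP; rewrite -subr_eq0; set P := _ - q; apply/negPn/negP => ne0.
  have roots : all (root P) [seq a x | x <- enum W].
    apply/allP => y /mapP[x xW {y}->]; rewrite mem_enum in xW.
    rewrite rootE hornerD hornerN horner_sum (bigD1 x) //= big1 ?addr0; last first.
      move=> y /andP[yW yx]; rewrite hornerZ /N horner_prod (bigD1 x) /=.
        by rewrite hornerXsubC subrr mul0r mulr0.
      by rewrite !inE eq_sym yx.
    rewrite hornerZ /c /N horner_prod -mulrA -big_split /= big1 ?mulr1 ?subrr //.
    move=> j; rewrite !inE => /andP[jx _]; rewrite hornerXsubC mulVf // subr_eq0.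
    by rewrite (inj_eq a_inj) eq_sym.
  have := max_poly_roots ne0 roots; rewrite map_inj_uniq // enum_uniq size_map -cardE.
  move=> /(_ isT); apply/negP; rewrite -leqNgt.
  apply: leq_trans (size_polyD _ _) _; rewrite geq_max size_polyN (ltnW ltqW) andbT.
  apply: leq_trans (size_sum _ _ _) _; apply/bigmax_leqP => x xW.
  by rewrite -(sN x xW) size_scale_leq.
have := congr1 (fun r : {poly K} => r`_#|W|.-1) eq.
rewrite coef_sum [RHS]nth_default; last by rewrite -ltnS prednK // (leq_ltn_trans _ ltqW).
by move=> e0; rewrite -[RHS]e0; apply: eq_bigr => x xW; rewrite coefZ NW ?mulr1.
Qed.

(* When [I] is the whole index set and [n = p.*2.+1], these are, up to a
   common factor, the coefficients of the p x p Hankel determinant defining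
   the union of the (p-1)-secant spaces of the rational normal curve through
   [n] points of [P^(n-3)]; in general [theta] gives the product of two such
   forms, in the variables of [I] and of [~: I]. *)
Definition theta I p T : K := (#|T :&: I| == p)%:R *
  \prod_(i in T) \prod_(j | (j \notin T) && ((i \in I) == (j \in I))) (a i - a j)^-1.

Lemma theta_neq0 I T : theta I #|T :&: I| T != 0.
Proof.
rewrite /theta eqxx mul1r; apply/prodf_neq0 => i iT; apply/prodf_neq0 => j /andP[jT _].
rewrite invr_eq0 subr_eq0 (inj_eq a_inj).
by apply: contraNneq jT => <-.
Qed.

Lemma theta_eq0 I p T : #|T :&: I| != p -> theta I p T = 0.
Proof. by move/negPf=> e; rewrite /theta e mul0r. Qed.

(** Here [Z] is [I] or its complement. Adding [x] to [U] brings in the Lagrange weight of [x] on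
    [Z :\: U] and removes the factors [(a i - a x)^-1] with [i] in [U :&: Z]. This leaves a Lagrange
    sum for a polynomial of size at most [#|U :&: Z| + 2]. *)
Lemma theta_side_sum0 I Z U (g : {poly K}) :
  (forall i j, ((i \in I) == (j \in I)) = ((i \in Z) == (j \in Z))) ->
  (size g <= 2)%N -> ((#|U :&: Z|).*2 + 3 <= #|Z|)%N ->
  \sum_(x | (x \notin U) && (x \in Z)) g.[a x] *
    \prod_(i in x |: U)
       \prod_(j | (j \notin x |: U) && ((i \in I) == (j \in I))) (a i - a j)^-1 = 0.
Proof.
move=> IZ sg ltUZ.
pose C := \prod_(i in U)
  \prod_(j | (j \notin U) && ((i \in Z) == (j \in Z))) (a i - a j)^-1.
pose W := Z :\: U.
pose q := g * \prod_(i in U :&: Z) ((a i)%:P - 'X).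
have sum0 : \sum_(x in W) q.[a x] * \prod_(j in W :\ x) (a x - a j)^-1 = 0.
  apply: lagrange_sum0.
  have -> : #|W| = (#|Z| - #|U :&: Z|)%N by rewrite cardsD setIC.
  suff : (size q <= 2 + #|U :&: Z|)%N by lia.
  have szX i : size ((a i)%:P - 'X) = 2 by rewrite -opprB size_polyN size_XsubC.
  rewrite /q; set P := \prod_(i in _) _.
  have szP : (size P <= #|U :&: Z|.+1)%N.
    apply: leq_trans (size_prod_leq _ _) _; rewrite (eq_bigr (fun=> 2%N)) //.
    by rewrite sum_nat_const muln2 -addnn -addSn addnK.
  apply: leq_trans (size_polyMleq _ _) _.
  by rewrite -subn1 leq_subLR; apply: leq_trans (leq_add sg szP) _; rewrite addnS.
transitivity (C * \sum_(x in W) q.[a x] * \prod_(j in W :\ x) (a x - a j)^-1); last first.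
  by rewrite sum0 mulr0.
rewrite mulr_sumr; apply: eq_big => [x|x /andP[xU xZ]].
  by rewrite inE.
rewrite big_setU1 //=.
have -> : \prod_(j | (j \notin x |: U) && ((x \in I) == (j \in I))) (a x - a j)^-1
    = \prod_(j in W :\ x) (a x - a j)^-1.
  apply: eq_bigl => j; rewrite IZ xZ !inE negb_or.
  by case: (j == x); case: (j \in U); case: (j \in Z).
have -> : \prod_(i in U)
    \prod_(j | (j \notin x |: U) && ((i \in I) == (j \in I))) (a i - a j)^-1
  = C * \prod_(i in U :&: Z) (a i - a x).
  rewrite [X in C * X](_ : _ = \prod_(i in U) (if i \in Z then a i - a x else 1)).
    rewrite -big_split /=; apply: eq_bigr => i iU.
    case: ifPn => iZ.
      rewrite [X in X * _](bigD1 x) /=; last by rewrite xU xZ.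
      rewrite mulrAC mulVf ?mul1r.
        apply: eq_bigl => j; rewrite IZ iZ !inE.
        by case: (j == x); case: (j \in U); case: (j \in Z).
      by rewrite subr_eq0 (inj_eq a_inj); apply: contraNneq xU => <-.
    rewrite mulr1; apply: eq_bigl => j; rewrite IZ (negPf iZ) !inE.
    by case: eqVneq => [->|]; rewrite ?xZ ?andbF.
  by rewrite -big_mkcondr; apply: eq_bigl => i; rewrite inE.
rewrite /q hornerM horner_prod.
under [in RHS]eq_bigr => i _ do rewrite hornerD hornerN hornerC hornerX.
by ring.
Qed.

(** Elements of [I] contribute only if [#|U :&: I|.+1 = p], the others only if [#|U :&: I| = p]; the
    bounds leave enough interpolation points in each case that can occur. *)
Lemma theta_sum0 I p U (g : {poly K}) :
  (size g <= 2)%N -> (p.*2 < #|I|)%N ->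
  (#|U|.+1 = p \/ (#|U|.+1 - p).*2 < #|~: I|)%N ->
  \sum_(x | x \notin U) g.[a x] * theta I p (x |: U) = 0.
Proof.
move=> sg pI pI'.
pose G x := g.[a x] * \prod_(i in x |: U)
  \prod_(j | (j \notin x |: U) && ((i \in I) == (j \in I))) (a i - a j)^-1.
have cU : #|U| = (#|U :&: I| + #|U :&: ~: I|)%N by rewrite -setDE cardsID.
rewrite (bigID (mem I)) /=.
rewrite (eq_bigr (fun x => (#|U :&: I|.+1 == p)%:R * G x)); last first.
  move=> x /andP[xU xI]; rewrite mulrCA /G; congr (_ * _).
  by rewrite setIUl (setIidPl _) ?sub1set // cardsU1 inE (negPf xU).
rewrite [X in _ + X](eq_bigr (fun x => (#|U :&: I| == p)%:R * G x)); last first.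
  move=> x /andP[xU xI]; rewrite mulrCA /G; congr (_ * _).
  rewrite setIUl (_ : [set x] :&: I = set0) ?set0U //.
  by apply/setP => y; rewrite !inE; case: eqP => // ->; rewrite (negPf xI).
rewrite -!mulr_sumr.
have [e1|_] := eqVneq _ p.
  rewrite (negPf (_ : #|U :&: I| != p)) ?mul0r ?addr0; last by lia.
  by rewrite theta_side_sum0 ?mulr0 //; lia.
rewrite mul0r add0r; have [e2|_] := eqVneq _ p; last by rewrite mul0r.
rewrite mul1r; under eq_bigl => x do rewrite -[x \notin I]in_setC.
apply: (@theta_side_sum0 I (~: I)) => //; last by lia.
by move=> i j; rewrite !inE; do 2!case: (_ \in I).
Qed.

(** The exponents 0 and 1 give the two blocks of the pencil. *)
Lemma up_theta0 I p k e : (e <= 1)%N -> (p.*2 < #|I|)%N ->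
  (k.+1 = p \/ (k.+1 - p).*2 < n - #|I|)%N ->
  up k (fun x => a x ^+ e) *m col_of k.+1 (theta I p) = 0.
Proof.
move=> e1 pI pI'; rewrite up_col_of; apply/colP => i; rewrite !mxE.
have := @theta_sum0 I p (enum_val i) 'X^e.
rewrite size_polyXn ltnS e1 card_enum_val_layer [#|~: I|]cardsCs setCK card_ord.
move=> /(_ isT pI pI') sum0; apply: etrans sum0.
by apply: eq_bigr => x _; rewrite hornerXn.
Qed.

End Theta.

Section ThetaRank.
Variables (K : fieldType) (n k e : nat) (I T : 'I_e -> {set 'I_n}).
Hypothesis card_T : forall s, #|T s| = k.+1.
Hypothesis card_I : forall s, (#|T s :&: I s|.*2 < #|I s|)%N.
Hypothesis card_I' : forall s,
  k.+1 = #|T s :&: I s| \/ ((k.+1 - #|T s :&: I s|).*2 < n - #|I s|)%N.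
Hypothesis triangular : forall s s' : 'I_e, (s < s')%N ->
  #|T s :&: I s'| != #|T s' :&: I s'|.

(** The [theta] columns lie in the right null space of the pencil. Their values at the sets [T s]
    form a triangular matrix with nonzero diagonal, so they are independent. *)
Lemma rank_pencil_theta (a : 'I_n -> K) : injective a ->
  (\rank (pencil k a) + e <= 'C(n, k.+1))%N.
Proof.
move=> a_inj; pose c s := theta a (I s) #|T s :&: I s|.
pose W := \matrix_(i < #|layer n k.+1|, s < e) c s (enum_val i).
have colW s : col s W = col_of k.+1 (c s) by apply/colP => i; rewrite !mxE.
have upW d : (d <= 1)%N -> up k (fun x => a x ^+ d) *m W = 0.
  move=> d1; apply/matrixP => i s.
  transitivity (col s (up k (fun x => a x ^+ d) *m W) i 0); first by rewrite [RHS]mxE.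
  by rewrite colE -mulmxA -colE colW up_theta0 // !mxE.
have PW : pencil k a *m W = 0.
  have e0 : up k (fun=> 1) = up k (fun x => a x ^+ 0) by apply: eq_up => x; rewrite expr0.
  have e1 : up k a = up k (fun x => a x ^+ 1) by apply: eq_up => x; rewrite expr1.
  by rewrite /pencil mul_col_mx e0 e1 !upW // col_mx0.
have TL s : T s \in layer n k.+1 by rewrite in_layer card_T.
pose R := \matrix_(s < e, i < #|layer n k.+1|) (enum_val i == T s)%:R : 'M[K]__.
have RW s s' : (R *m W) s s' = c s' (T s).
  rewrite mxE (bigD1 (enum_rank_in (TL s) (T s))) //= !mxE enum_rankK_in ?TL // eqxx mul1r.
  rewrite big1 ?addr0 // => i ne; rewrite !mxE; case: eqP => [ei|]; rewrite ?mul0r //.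
  by case/eqP: ne; apply: enum_val_inj; rewrite enum_rankK_in ?TL.
have unitRW : R *m W \in unitmx.
  rewrite unitmxE det_trig.
    by rewrite unitfE; apply/prodf_neq0 => s _; rewrite RW theta_neq0.
  by apply/is_trig_mxP => s s' ss'; rewrite RW /c theta_eq0 ?triangular.
have := mulmx0_rank_max PW; rewrite [X in (_ <= X)%N]card_layer; apply: leq_trans.
rewrite leq_add2l -[X in (X <= _)%N](mxrank_unit unitRW); exact: mxrankM_maxr.
Qed.

End ThetaRank.

(** * Failure of maximal rank *)

(** Lists of numbers stand for sets so that the conditions on a family can be decided by
    computation. *)
Definition set_of_seq n (s : seq nat) : {set 'I_n} := [set x | val x \in s].

Lemma card_set_of_seq n s : #|set_of_seq n s| = count (mem s) (iota 0 n).
Proof.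
rewrite cardsE cardE size_filter -val_enum_ord count_map enumT.
by apply: eq_count => x.
Qed.

Lemma set_of_seqI n s t :
  set_of_seq n s :&: set_of_seq n t = set_of_seq n [seq x <- s | x \in t].
Proof. by apply/setP => x; rewrite !inE mem_filter andbC. Qed.

Definition count_meet n (s t : seq nat) :=
  count [pred x | (x \in s) && (x \in t)] (iota 0 n).

Lemma card_meet n s t : #|set_of_seq n s :&: set_of_seq n t| = count_meet n s t.
Proof.
rewrite set_of_seqI card_set_of_seq; apply: eq_count => x /=.
by rewrite mem_filter andbC.
Qed.

(* Each pair in [D] is [(I, T)]; the last condition makes the matrix of the
   coefficients of the [theta I] at the sets [T] triangular. *)
Definition theta_family n k (D : seq (seq nat * seq nat)) : bool :=
  all (fun IT => let: (J, T) := IT in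
    [&& count (mem T) (iota 0 n) == k.+1,
        ((count_meet n T J).*2 < count (mem J) (iota 0 n))%N &
        ((k.+1 - count_meet n T J).*2 < n - count (mem J) (iota 0 n))%N]) D &&
  pairwise (fun IT IT' => count_meet n IT.2 IT'.1 != count_meet n IT'.2 IT'.1) D.

Lemma rank_pencil_family (K : fieldType) n k D (a : 'I_n -> K) :
  theta_family n k D -> injective a ->
  (\rank (pencil k a) + size D <= 'C(n, k.+1))%N.
Proof.
case/andP => /allP all_D pw_D.
pose IT := fun s : 'I_(size D) => nth ([::], [::]) D s.
have ITP s := all_D _ (mem_nth ([::], [::]) (ltn_ord s)).
apply: (@rank_pencil_theta _ _ _ _ (fun s => set_of_seq n (IT s).1)
          (fun s => set_of_seq n (IT s).2)) => [s|s|s|s s' ss'].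
- by have := ITP s; rewrite card_set_of_seq /IT; case: nth => J T /and3P[/eqP].
- by have := ITP s; rewrite card_meet card_set_of_seq /IT; case: nth => J T /and3P[].
- right; have := ITP s; rewrite card_meet card_set_of_seq /IT.
  by case: nth => J T /and3P[].
- rewrite !card_meet.
  by move/(pairwiseP ([::], [::])): pw_D; apply; rewrite ?inE.
Qed.

Section NoMaxRank.
Variables (K : closedFieldType) (K_char0 : [pchar K] =i pred0).

(** Semicontinuity extends the rank bound to all [a]. Surjectivity then fails because [e > 0], and
    injectivity by the count in [kermx_up_rank]. *)
Lemma no_max_rank n d e :
  (forall a : 'I_n -> K, injective a ->
     (\rank (pencil d.+1 a) + e <= 'C(n, d.+2))%N) ->
  (d.+1.*2 < n)%N -> (0 < e <= 'C(n, d.+2))%N ->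
  ('C(n, d.+2) + 'C(n, d) < ('C(n, d.+1)).*2 + e)%N ->
  forall a : 'I_n -> K,
    ~~ row_full (pencil d.+1 a) /\
    ~ (forall v : 'rV[K]_#|layer n d.+1|,
        (v *m up d.+1 a <= up d.+1 (fun=> 1) -> v <= up d (fun=> 1))%MS).
Proof.
move=> rk ltdn /andP[e0 leC] ltC a.
have {}rk : (\rank (pencil d.+1 a) <= 'C(n, d.+2) - e)%N.
  apply: rank_pencil_semicont => // a' /rk; lia.
split.
  rewrite /row_full neq_ltn (leq_ltn_trans rk) //.
  by rewrite [X in (_ < X)%N]card_layer; lia.
by move/kermx_up_rank => /(_ K_char0 ltdn); lia.
Qed.

(** Multiplication by [d.+2 * (n - d)] turns both outer binomials into multiples of
    ['C(n, d.+1)]. *)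
Lemma bin_concave n d : ((n - d) * (n - d.+1) + d.+1 * d.+2 <= (d.+2 * (n - d)).*2)%N ->
  (d < n)%N -> ('C(n, d.+2) + 'C(n, d) <= ('C(n, d.+1)).*2)%N.
Proof.
move=> le dn; rewrite -(@leq_pmul2l (d.+2 * (n - d))); last by rewrite muln_gt0; lia.
have e2 := mul_bin_left n d.+1; have e0 := mul_bin_left n d.
have -> : (d.+2 * (n - d) * ('C(n, d.+2) + 'C(n, d)) =
  (n - d) * (d.+2 * 'C(n, d.+2)) + d.+2 * ((n - d) * 'C(n, d)))%N by ring.
rewrite e2 -e0.
have := leq_mul le (leqnn 'C(n, d.+1)); rewrite -!muln2; nia.
Qed.

End NoMaxRank.

(* Both families were found by a greedy computer search. The dual of the
   cokernel is expected to have dimension 15 for [n = 10], 22 for [n = 12]. *)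
Definition family10 : seq (seq nat * seq nat) :=
  [::
     ([:: 9], [:: 0; 3; 5; 8]);
     ([:: 0; 3; 9], [:: 2; 4; 6; 9]);
     ([:: 1; 2; 9], [:: 2; 4; 6; 7]);
     ([:: 1; 2; 4; 6; 8], [:: 0; 1; 3; 8]);
     ([:: 1; 2; 4; 5; 6], [:: 1; 3; 5; 8]);
     ([:: 2; 4; 9], [:: 1; 3; 5; 9]);
     ([:: 1; 3; 5; 7; 8], [:: 4; 6; 7; 8]);
     ([:: 1; 2; 3; 5; 8], [:: 0; 1; 3; 9]);
     ([:: 0; 1; 3; 5; 7], [:: 0; 5; 8; 9]);
     ([:: 0; 1; 5], [:: 1; 4; 6; 7]);
     ([:: 0; 3; 5], [:: 2; 4; 5; 7]);
     ([:: 2; 4; 6; 7; 8], [:: 1; 4; 8; 9]);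
     ([:: 2; 4; 5; 6; 7], [:: 0; 3; 6; 7]);
     ([:: 0; 2; 4; 6; 7], [:: 2; 3; 5; 7]);
     ([:: 2; 6; 7], [:: 2; 3; 4; 9]);
     ([:: 2; 3; 4; 6; 7], [:: 1; 4; 6; 9])
  ].

Definition family12 : seq (seq nat * seq nat) :=
  [::
     ([:: 11], [:: 1; 4; 5; 6; 9]);
     ([:: 1; 4; 11], [:: 2; 3; 7; 10; 11]);
     ([:: 0; 2; 11], [:: 2; 3; 7; 8; 10]);
     ([:: 1; 4; 5; 8; 11], [:: 0; 1; 5; 6; 9]);
     ([:: 1; 5; 6; 8; 11], [:: 0; 1; 4; 6; 9]);
     ([:: 1; 6; 8; 9; 11], [:: 2; 3; 8; 10; 11]);
     ([:: 0; 1; 4; 5; 11], [:: 2; 3; 5; 7; 11]);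
     ([:: 2; 8; 11], [:: 3; 5; 7; 10; 11]);
     ([:: 7; 8; 11], [:: 2; 3; 5; 10; 11]);
     ([:: 3; 8; 11], [:: 0; 1; 4; 8; 9]);
     ([:: 0; 1; 4; 6; 11], [:: 2; 3; 4; 10; 11]);
     ([:: 0; 1; 6; 9; 10], [:: 2; 3; 9; 10; 11]);
     ([:: 0; 1; 6], [:: 1; 2; 3; 10; 11]);
     ([:: 2; 3; 5; 8; 11], [:: 4; 5; 6; 8; 9]);
     ([:: 0; 4; 6; 7; 9], [:: 1; 4; 5; 6; 8]);
     ([:: 1; 4; 6; 7; 9], [:: 2; 7; 9; 10; 11]);
     ([:: 2; 3; 11], [:: 0; 4; 6; 9; 11]);
     ([:: 1; 2; 3; 7; 11], [:: 1; 4; 6; 9; 11]);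
     ([:: 4; 5; 6; 8; 9], [:: 0; 1; 4; 6; 11]);
     ([:: 2; 3; 7; 8; 11], [:: 0; 1; 8; 9; 11]);
     ([:: 0; 1; 4; 5; 9], [:: 0; 6; 8; 9; 11]);
     ([:: 0; 1; 5; 6; 9], [:: 0; 2; 3; 5; 7]);
     ([:: 3; 7; 10], [:: 4; 6; 7; 8; 9])
  ].

Lemma family10P : theta_family 10 3 family10 && (size family10 == 16)%N.
Proof. by vm_compute. Qed.

Lemma family12P : theta_family 12 4 family12 && (size family12 == 23)%N.
Proof. by vm_compute. Qed.

Section Fail.
Variables (K : closedFieldType) (K_char0 : [pchar K] =i pred0).

(** A single [theta] suffices: [I] is the whole index set and [T] any set of the right size, here an
    initial segment. *)
Lemma rank_pencil_setT n k (a : 'I_n -> K) : (k.+1.*2 < n)%N -> injective a ->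
  (\rank (pencil k a) + 1 <= 'C(n, k.+1))%N.
Proof.
move=> kn; have cT : #|[set x : 'I_n | (x < k.+1)%N]| = k.+1.
  rewrite -sum1_card; under eq_bigl => x do rewrite inE.
  by rewrite -(big_ord_widen n (fun=> 1%N)) ?sum1_card ?card_ord //; lia.
apply: (@rank_pencil_theta _ _ _ _ (fun=> setT) (fun=> [set x : 'I_n | (x < k.+1)%N])).
- by [].
- by move=> _; rewrite setIT cT cardsT card_ord.
- by move=> _; left; rewrite setIT cT.
- by move=> [[|//] ?] [[|//] ?].
Qed.

Lemma exists_no_max_rank r : r = 6%N \/ (8 <= r)%N -> exists d,
  forall a : 'I_r.+1 -> K,
    ~~ row_full (pencil d.+1 a) /\
    ~ (forall v : 'rV[K]_#|layer r.+1 d.+1|,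
        (v *m up d.+1 a <= up d.+1 (fun=> 1) -> v <= up d (fun=> 1))%MS).
Proof.
move=> hr.
(* The families are just large enough: 210 + 45 < 240 + 16 here, and 792 + 220 < 990 + 23 for
   [r = 11]. *)
have [r9|r9] := eqVneq r 9.
  exists 2%N; rewrite r9; apply: (@no_max_rank K K_char0 10 2 16) => //.
  by have /andP[F /eqP <-] := family10P; move=> a; apply: rank_pencil_family.
have [r11|r11] := eqVneq r 11.
  exists 3%N; rewrite r11; apply: (@no_max_rank K K_char0 12 3 23) => //.
  by have /andP[F /eqP <-] := family12P; move=> a; apply: rank_pencil_family.
(* The target degree [d.+2] is [k]. Concavity reduces to [k >= 3] for even [r] and to [k >= 6] for
   odd [r], which is why 9 and 11 are treated apart. *)
pose k := r./2; have rk : r = (odd r + k.*2)%N by rewrite odd_double_half.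
exists (k - 2)%N; apply: (@no_max_rank _ _ _ _ 1) => //.
- by move=> a; apply: rank_pencil_setT; lia.
- by lia.
- by rewrite bin_gt0; lia.
rewrite addn1 ltnS; apply: bin_concave; last by lia.
have [j kj] : exists j, k = (j + 3)%N by exists (k - 3)%N; lia.
case: (odd r) rk => rk; rewrite rk kj; last by rewrite -!muln2; nia.
by rewrite -!muln2; nia.
Qed.

End Fail.

(** * Fraction-free elimination *)

(** Division by the gcd keeps the entries small; multiplying back is tested during the computation
    and replaces a proof about [Z.gcd]. *)
Definition primitive (r : seq Z) : seq Z :=
  let g := foldr Z.gcd Z0 r in
  let r' := [seq Z.div x g | x <- r] in
  if (g != Z0) && ([seq Z.mul g x | x <- r'] == r) then r' else r.

Definition cancel_head (p r : seq Z) : seq Z :=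
  [seq Z.sub (Z.mul (head Z0 p) xy.2) (Z.mul (head Z0 r) xy.1)
     | xy <- zip (behead p) (behead r)].

(* Returns the positions of the unknowns without a pivot. *)
Fixpoint free_unknowns (N : nat) (rows : seq (seq Z)) : seq nat :=
  if N is N'.+1 then
    let rows0 := [seq behead r | r <- rows & head Z0 r == Z0] in
    if [seq r <- rows | head Z0 r != Z0] is p :: ps then
      let rows' := rows0 ++ [seq primitive (cancel_head p r) | r <- ps] in
      [seq i.+1 | i <- free_unknowns N' rows']
    else 0%N :: [seq i.+1 | i <- free_unknowns N' rows0]
  else [::].

Section Elimination.
Variables (K : fieldType) (K_char0 : [pchar K] =i pred0).

Definition ZtoK (z : Z) : K := (int_of_Z z)%:~R.

Lemma ZtoK0 : ZtoK Z0 = 0. Proof. by []. Qed.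

Lemma ZtoKM x y : ZtoK (Z.mul x y) = ZtoK x * ZtoK y.
Proof. by rewrite /ZtoK -intrM; congr intmul; rewrite -rmorphM. Qed.

Lemma ZtoKB x y : ZtoK (Z.sub x y) = ZtoK x - ZtoK y.
Proof. by rewrite /ZtoK -intrB; congr intmul; rewrite -rmorphB. Qed.

Lemma ZtoK_nat m : ZtoK (Z.of_nat m) = m%:R.
Proof. by rewrite /ZtoK -[Z.of_nat m]/(Z_of_int m) Z_of_intK. Qed.

Lemma ZtoK_eq0 z : (ZtoK z == 0) = (z == Z0).
Proof.
apply/eqP/eqP => [|-> //]; rewrite /ZtoK => e.
have : int_of_Z z = 0.
  case: (int_of_Z z) e => [m|m] /eqP; first by rewrite -pmulrn natr_eq0 // => /eqP ->.
  by rewrite NegzE mulrNz oppr_eq0 -pmulrn natr_eq0.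
by move/(congr1 Z_of_int); rewrite int_of_ZK.
Qed.

Fixpoint dot (r : seq Z) (v : seq K) : K :=
  match r, v with c :: r', x :: v' => ZtoK c * x + dot r' v' | _, _ => 0 end.

Lemma dot_scale g r v : dot [seq Z.mul g x | x <- r] v = ZtoK g * dot r v.
Proof.
elim: r v => [|c r IH] [|x v]; rewrite /= ?mulr0 // IH ZtoKM; ring.
Qed.

Lemma dot_primitive r v : dot r v = 0 -> dot (primitive r) v = 0.
Proof.
rewrite /primitive; case: ifP => // /andP[g0 /eqP e].
rewrite -{1}e dot_scale => /eqP; rewrite mulf_eq0 ZtoK_eq0 (negPf g0).
by move/eqP.
Qed.

Lemma size_primitive r : size (primitive r) = size r.
Proof. by rewrite /primitive; case: ifP; rewrite // size_map. Qed.

Lemma dot_cancel_head p r x v : size p = size r ->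
  dot p (x :: v) = 0 -> dot r (x :: v) = 0 -> dot (cancel_head p r) v = 0.
Proof.
case: p r => [|c p] [|d r] //= [].
have -> : dot (cancel_head (c :: p) (d :: r)) v =
    if size p == size r then ZtoK c * dot r v - ZtoK d * dot p v
    else dot (cancel_head (c :: p) (d :: r)) v.
  case: eqP => // e; rewrite /cancel_head /=.
  elim: p r v e => [|c' p IH] [|d' r] [|y v] //= => [_|_|_|[/IH ->]]; rewrite ?mulr0 ?subr0 //.
  by rewrite ZtoKB !ZtoKM; ring.
move=> e; rewrite e eqxx => ec ed.
have -> : dot p v = - (ZtoK c * x) by apply/eqP; rewrite -addr_eq0 addrC ec.
have -> : dot r v = - (ZtoK d * x) by apply/eqP; rewrite -addr_eq0 addrC ed.
by ring.
Qed.

Lemma size_cancel_head p r : size p = size r -> size (cancel_head p r) = (size r).-1.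
Proof.
by move=> e; rewrite size_map size_zip !size_behead e minnn.
Qed.

Lemma dot0 r v : {in v, forall x, x = 0} -> dot r v = 0.
Proof.
elim: r v => [|c r IH] [|x v] //= v0; rewrite (v0 x) ?mem_head // mulr0 add0r IH //.
by move=> y yv; apply: v0; rewrite inE yv orbT.
Qed.

Lemma free_unknownsP N rows (v : seq K) : size v = N ->
  {in rows, forall r, size r = N /\ dot r v = 0} ->
  {in free_unknowns N rows, forall i, v`_i = 0} ->
  {in v, forall x, x = 0}.
Proof.
elim: N rows v => [|N IH] rows [|x v] //= [sv] rows0 free0.
have rows'0 : {in [seq behead r | r <- rows & head Z0 r == Z0],
    forall r, size r = N /\ dot r v = 0}.
  move=> r1 /mapP[r rin {r1}->]; move: rin; rewrite mem_filter => /andP[/eqP r0 rr].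
  have [] := rows0 _ rr; case: r r0 {rr} => [|c r] //= -> [->].
  by rewrite ZtoK0 mul0r add0r.
move: free0; case e: [seq r <- rows | head Z0 r != Z0] => [|p ps] free0.
  have v0 : {in v, forall y, y = 0}.
    apply: IH rows'0 _ => // i iF.
    by apply: (free0 i.+1); rewrite inE map_f.
  move=> y; rewrite inE => /predU1P[->|/v0 //].
  by apply: (free0 0%N); rewrite mem_head.
have /andP[p0 prow] : (head Z0 p != Z0) && (p \in rows).
  by rewrite -(mem_filter (fun r => head Z0 r != Z0)) e mem_head.
have [sp dp] := rows0 _ prow.
have v0 : {in v, forall y, y = 0}.
  apply: (IH ([seq behead r | r <- rows & head Z0 r == Z0] ++
              [seq primitive (cancel_head p r) | r <- ps])) => // [r|i iF]; last first.
    by apply: (free0 i.+1); rewrite map_f.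
  rewrite mem_cat => /orP[/rows'0 //|/mapP[q qps ->]].
  have qrow : q \in rows.
    have : q \in [seq r <- rows | head Z0 r != Z0] by rewrite e inE qps orbT.
    by rewrite mem_filter => /andP[].
  have [sq dq] := rows0 _ qrow.
  rewrite size_primitive size_cancel_head ?sp ?sq //; split=> //.
  by apply/dot_primitive/(dot_cancel_head _ dp dq); rewrite sp sq.
move=> y; rewrite inE => /predU1P[->|/v0 //].
case: p p0 dp {e prow sp free0} => [|c p] //= c0.
rewrite dot0 // addr0 => /eqP; rewrite mulf_eq0 ZtoK_eq0 (negPf c0).
by move/eqP.
Qed.

Fixpoint add_at (i : nat) (c : Z) (r : seq Z) : seq Z :=
  match i, r with
  | 0%N, d :: r' => Z.add c d :: r'
  | i'.+1, d :: r' => d :: add_at i' c r'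
  | _, [::] => [::]
  end.

Lemma size_add_at i c r : size (add_at i c r) = size r.
Proof. by elim: r i => [|d r IH] [|i] //=; rewrite IH. Qed.

Lemma ZtoKD x y : ZtoK (Z.add x y) = ZtoK x + ZtoK y.
Proof. by rewrite /ZtoK -intrD; congr intmul; rewrite -rmorphD. Qed.

Lemma dot_add_at i c r v : size v = size r ->
  dot (add_at i c r) v = ZtoK c * v`_i + dot r v.
Proof.
elim: r i v => [|d r IH] [|i] [|x v] //=; rewrite ?mulr0 ?addr0 //.
  by rewrite ZtoKD; move=> _; ring.
by case=> /IH ->; ring.
Qed.

End Elimination.

Definition sparse_row (N : nat) (l : seq (nat * Z)) : seq Z :=
  foldr (fun ic r => add_at ic.1 ic.2 r) (nseq N Z0) l.

Lemma size_sparse_row N l : size (sparse_row N l) = N.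
Proof. by elim: l => [|ic l IH] /=; rewrite ?size_nseq ?size_add_at. Qed.

Lemma dot_sparse_row (K : fieldType) N l (v : seq K) : size v = N ->
  dot (sparse_row N l) v = \sum_(ic <- l) ZtoK K ic.2 * v`_ic.1.
Proof.
move=> sv; elim: l => [|ic l IH] /=.
  rewrite big_nil; elim: N v sv => [|N IH] [|x v] //= [/IH ->].
  by rewrite ZtoK0 mul0r addr0.
by rewrite dot_add_at ?size_sparse_row // IH big_cons.
Qed.

(** * The nullity of the pencil by computation *)

Fixpoint sublists (s : seq nat) : seq (seq nat) :=
  if s is x :: s' then
    let l := sublists s' in [seq x :: t | t <- l] ++ l
  else [:: [::]].

Lemma filter_sublists (P : pred nat) s : filter P s \in sublists s.
Proof.
elim: s => //= x s IH; rewrite mem_cat; case: (P x); last by rewrite IH orbT.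
by rewrite map_f.
Qed.

(** Each set is represented by its increasing list, so that [index] finds an unknown by equality of
    lists. *)
Definition layer_seq n d :=
  [seq s <- sublists (iota 0 n) | count (mem s) (iota 0 n) == d].

(* The unknowns are the coefficients of a form killed by the transposes of
   the two blocks of [pencil k (fun x => x%:R)]. *)
Definition pencil_equations n k : seq (seq Z) :=
  let unknowns := layer_seq n k.+1 in
  let N := size unknowns in
  [seq sparse_row N
         [seq (index [seq y <- iota 0 n | (y == x) || (y \in s)] unknowns,
               if b : bool then Z.of_nat x else Z.one) | x <- iota 0 n & x \notin s]
     | b <- [:: false; true], s <- layer_seq n k].

Definition pencil_nullity n k : nat :=
  size (free_unknowns (size (layer_seq n k.+1)) (pencil_equations n k)).

Lemma set_of_filter n (P : pred nat) :
  set_of_seq n [seq y <- iota 0 n | P y] = [set x : 'I_n | P x].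
Proof.
by apply/setP => x; rewrite !inE mem_filter mem_iota add0n ltn_ord !andbT.
Qed.

Lemma filter_layer_seq n d (P : pred nat) : #|[set x : 'I_n | P x]| = d ->
  [seq y <- iota 0 n | P y] \in layer_seq n d.
Proof.
move=> cP; rewrite mem_filter filter_sublists andbT -card_set_of_seq.
by rewrite set_of_filter cP.
Qed.

Lemma layer_seqE n d (T : {set 'I_n}) : T \in layer n d ->
  exists2 s, s \in layer_seq n d & set_of_seq n s = T.
Proof.
rewrite in_layer => /eqP cT; pose P y := y \in [seq val x | x <- enum T].
have eP : [set x : 'I_n | P x] = T.
  by apply/setP => x; rewrite inE /P mem_map ?mem_enum //; apply: val_inj.
exists [seq y <- iota 0 n | P y]; last by rewrite set_of_filter.
by apply: filter_layer_seq; rewrite eP.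
Qed.

Section Nullity.
Variables (K : fieldType) (K_char0 : [pchar K] =i pred0).

Lemma rank_pencil_nullity n k :
  ('C(n, k.+1) <= \rank (pencil k (fun x : 'I_n => x%:R : K)) + pencil_nullity n k)%N.
Proof.
pose fr := free_unknowns (size (layer_seq n k.+1)) (pencil_equations n k).
pose nthset i := set_of_seq n (nth [::] (layer_seq n k.+1) i).
(* [R] reads off the coefficients at the unknowns without a pivot, which determine a null vector. *)
pose R : 'M[K]_(size fr, #|layer n k.+1|) :=
  \matrix_(i, j) (enum_val j == nthset (nth 0%N fr i))%:R.
rewrite -card_layer; apply: (@row_full_col_mx_rank _ _ _ _ _ R) => f Pf0 Rf0.
pose g := fun_of_col f; have fE : f = col_of k.+1 g by rewrite fun_of_colK.
pose v := [seq g (set_of_seq n s) | s <- layer_seq n k.+1].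
have v0 : {in v, forall y, y = 0}.
  apply: (free_unknownsP K_char0 (size_map _ _)) => [r|i ifr]; last first.
    have [lt_i|le_i] := ltnP i (size (layer_seq n k.+1)); last first.
      by rewrite nth_default // size_map.
    rewrite (nth_map [::]) //; have ltj : (index i fr < size fr)%N.
      by rewrite index_mem; exact: ifr.
    move/colP/(_ (Ordinal ltj)): Rf0; rewrite !mxE => <-.
    rewrite /g /fun_of_col big_mkcond /=; apply: eq_bigr => j _.
    by rewrite !mxE /= nth_index //; case: eqP; rewrite ?mul1r ?mul0r.
  case/allpairsP => -[b s] /= [_ sL ->]; rewrite size_sparse_row; split=> //.
  rewrite dot_sparse_row ?size_map // big_map big_filter.
  have SL : set_of_seq n s \in layer n k.
    by move: sL; rewrite mem_filter in_layer card_set_of_seq => /andP[].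
  have [P0 P1] : up k (fun=> 1) *m f = 0 /\ up k (fun x => x%:R) *m f = 0.
    by move/eqP: Pf0; rewrite /pencil mul_col_mx col_mx_eq0 => /andP[/eqP -> /eqP ->].
  have /colP/(_ (enum_rank_in SL (set_of_seq n s))) :
      up k (fun x => if b then x%:R else 1) *m f = 0 by case: (b).
  rewrite fE up_col_of !mxE enum_rankK_in // => rhs0.
  have bigE (F : nat -> K) :
      \sum_(x <- iota 0 n | x \notin s) F x = \sum_(x < n | val x \notin s) F x.
    by rewrite -[X in iota 0 X]subn0 -/(index_iota 0 n) big_mkord.
  rewrite bigE; apply: etrans rhs0; apply: eq_big => [x|x xs]; first by rewrite inE.
  have eU : [set y : 'I_n | (y == x :> nat) || (val y \in s)] = x |: set_of_seq n s.
    by apply/setP => y; rewrite !inE.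
  have tL : [seq y <- iota 0 n | (y == val x) || (y \in s)] \in layer_seq n k.+1.
    apply: filter_layer_seq; rewrite eU cardsU1 inE xs add1n.
    by move: SL; rewrite in_layer => /eqP ->.
  rewrite (nth_map [::]) ?index_mem // nth_index // set_of_filter eU; congr (_ * _).
  by case: b; rewrite ?ZtoK_nat.
rewrite fE; apply/colP => j; rewrite !mxE.
have /layer_seqE[s sL <-] := enum_valP j.
by apply: v0; apply: map_f.
Qed.

End Nullity.

(** * Maximal rank in small dimension *)

Section Propagation.
Variables (K : fieldType) (n : nat) (a : 'I_n -> K).

Lemma row_full_pencilS k : row_full (pencil k a) -> row_full (pencil k.+1 a).
Proof.
move=> /row_fullP[C CP].
have inj f : pencil k a *m f = 0 -> f = 0 :> 'cV_#|layer n k.+1|.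
  by move=> f0; rewrite -[f]mul1mx -CP -mulmxA f0 mulmx0.
rewrite /row_full eqn_leq rank_leq_col /= -[X in (_ <= X)%N]addn0.
apply: (@row_full_col_mx_rank _ _ 0 _ _ 0) => f /eqP.
rewrite /pencil mul_col_mx col_mx_eq0 => /andP[/eqP f1 /eqP fa] _.
pose g := fun_of_col f; have fE : f = col_of k.+2 g by rewrite fun_of_colK.
(* [gx x] gives the coefficients of the derivative with respect to ['X_x]. *)
pose gx x (S : {set 'I_n}) := if x \in S then 0 else g (x |: S).
have killed c x : up k.+1 c *m f = 0 -> up k c *m col_of k.+1 (gx x) = 0.
  rewrite fE !up_col_of => f0; apply/colP => i; rewrite !mxE.
  set S := enum_val i; rewrite /gx.
  have [xS|xS] := boolP (x \in S).
    by apply: big1 => y _; rewrite !inE xS orbT mulr0.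
  have xSL : x |: S \in layer n k.+1 by apply: layer_setU1 xS; apply: enum_valP.
  move/colP/(_ (enum_rank_in xSL (x |: S))): f0; rewrite !mxE enum_rankK_in // => f0.
  apply: etrans f0; rewrite (bigD1 x) //= !inE eqxx mulr0 add0r.
  apply: eq_big => [y|y /andP[yS yx]]; first by rewrite !inE negb_or andbC.
  by rewrite !inE eq_sym (negPf yx) (negPf xS) setUCA.
have gx0 x : col_of k.+1 (gx x) = 0.
  by apply: inj; rewrite /pencil mul_col_mx !killed // col_mx0.
rewrite fE; apply/colP => j; rewrite !mxE; set T := enum_val j.
have TL : T \in layer n k.+2 by apply: enum_valP.
have /set0Pn[x xT] : T != set0 by rewrite -card_gt0 card_enum_val_layer.
have TxL := layer_setD1 TL xT.
move/colP/(_ (enum_rank_in TxL (T :\ x))): (gx0 x).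
by rewrite !mxE enum_rankK_in // /gx setD11 setD1K.
Qed.

Lemma row_full_pencil_leq k d : row_full (pencil k a) -> (k <= d)%N ->
  row_full (pencil d a).
Proof.
move=> fk; elim: d => [|d IH]; first by rewrite leqn0 => /eqP <-.
by rewrite leq_eqVlt => /predU1P[<- //|/IH]; apply: row_full_pencilS.
Qed.

End Propagation.

Section Positive.
Variables (K : fieldType) (K_char0 : [pchar K] =i pred0).
Let natw n (x : 'I_n) : K := x%:R.

(* Degree [0] is left out: there injectivity only requires [a] not to be
   constant. *)
Definition max_rank n (a : 'I_n -> K) d : Prop :=
  [\/ d = 0%N, row_full (pencil d a) |
     exists2 k, d = k.+1 & forall v : 'rV[K]_#|layer n k.+1|,
       (v *m up k.+1 a <= up k.+1 (fun=> 1) -> v <= up k (fun=> 1))%MS].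

Lemma surj_nullity n k d : pencil_nullity n k == 0%N -> (k <= d)%N ->
  max_rank (@natw n) d.
Proof.
move=> /eqP e kd; apply: Or32; apply: row_full_pencil_leq kd.
have := rank_pencil_nullity K_char0 n k; rewrite e addn0 => le.
by rewrite /row_full eqn_leq rank_leq_col [X in (X <= _)%N]card_layer.
Qed.

Lemma inj_nullity n k : (k.+1.*2 < n)%N ->
  ('C(n, k.+1).*2 + pencil_nullity n k.+1 <= 'C(n, k.+2) + 'C(n, k))%N ->
  max_rank (@natw n) k.+1.
Proof.
move=> kn le; apply: Or33; exists k => //; apply/(kermx_up_rank K_char0 _ kn).
have := rank_pencil_nullity K_char0 n k.+1; rewrite -/(@natw n) => le'.
by rewrite -(leq_add2r (pencil_nullity n k.+1)); lia.
Qed.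

Lemma exists_max_rank r : (2 <= r <= 5)%N \/ r = 7%N ->
  exists2 a : 'I_r.+1 -> K, a ord0 != a ord_max & forall d, max_rank a d.
Proof.
move=> hr; exists (@natw r.+1) => [|[|d]]; [|by apply: Or31|].
  by rewrite /natw eq_sym /= natr_eq0 //; case: hr => [|-> //]; lia.
have : r \in [:: 2; 3; 4; 5; 7]%N by case: hr => [|->]; rewrite ?inE //; lia.
(* Surjectivity is computed in degree 1 for [r = 2, 3], degree 2 for [r = 4, 5] and degree 3 for
   [r = 7]; injectivity is computed in the positive degrees below. *)
rewrite !inE => /or4P[| | |/orP[]] /eqP->.
- by apply: (@surj_nullity 3 1) => //; vm_compute.
- by apply: (@surj_nullity 4 1) => //; vm_compute.
- case: d => [|d]; first by apply: inj_nullity => //; vm_compute.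
  by apply: (@surj_nullity 5 2) => //; vm_compute.
- case: d => [|d]; first by apply: inj_nullity => //; vm_compute.
  by apply: (@surj_nullity 6 2) => //; vm_compute.
case: d => [|[|d]]; [by apply: inj_nullity => //; vm_compute.. |].
by apply: (@surj_nullity 8 3) => //; vm_compute.
Qed.

End Positive.

(** * General position *)

Section GeneralPosition.
Variables (K : fieldType) (r : nat).

Definition coef_mx (l : linear_forms K r.+1 r) : 'M[K]_(r.+1, r) :=
  \matrix_(i, j) (l i : {mpoly K[r]})@_U_(j).

(* By Cramer's rule [cramer M] expresses [\det (row' 0 M) *: row 0 M] in
   terms of the other rows of [M]. *)
Definition cramer (R : comNzRingType) (M : 'M[R]_(r.+1, r)) : 'rV[R]_r :=
  row 0 M *m \adj (row' 0 M).

(** Nonzero exactly when the rows after the first form a basis and row 0 has only nonzero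
    coordinates in it. *)
Definition position_det (R : comNzRingType) (M : 'M[R]_(r.+1, r)) : R :=
  \det (row' 0 M) * \prod_j cramer M 0 j.

Definition position_poly : {mpoly K[r.+1 * r]} :=
  position_det (\matrix_(i < r.+1, j < r) 'X_(mxvec_index i j)).

Lemma position_polyE l : position_poly.@[coordinates l] = position_det (coef_mx l).
Proof.
rewrite /position_poly /position_det /cramer rmorphM rmorph_prod /=.
have e : map_mx (meval (coordinates l)) (\matrix_(i, j) 'X_(mxvec_index i j)) = coef_mx l.
  by apply/matrixP => i j; rewrite !mxE mevalXU /coordinates mxvecE mxE.
rewrite -e -map_row' -map_row -map_mx_adj -map_mxM det_map_mx; congr (_ * _).
by apply: eq_bigr => j _; rewrite [RHS]mxE.
Qed.

Definition general_position (l : linear_forms K r.+1 r) : Prop :=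
  position_poly.@[coordinates l] != 0.

Lemma general_position_open : zariski_open general_position.
Proof.
exists (eq position_poly) => l; split=> [l0|[_ <- //]].
by exists position_poly.
Qed.

Lemma general_position_ex : exists l, general_position l.
Proof.
(* The witness consists of the variables together with their sum. *)
pose a (i : 'I_r.+1) (k : 'I_r) : K := if unlift ord0 i is Some j then (j == k)%:R else 1.
exists (fun i => DHomog (linform_homog (a i))).
rewrite /general_position position_polyE /position_det; set M := coef_mx _.
have ME i k : M i k = a i k by rewrite mxE mcoeff_linform.
have eB : row' 0 M = 1%:M by apply/matrixP => j k; rewrite mxE ME /a liftK mxE.
have ecr : cramer M = const_mx 1.
  rewrite /cramer eB; have := mul_adj_mx (1%:M : 'M[K]_r).
  rewrite mulmx1 det1 => ->; rewrite mulmx1.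
  by apply/rowP => k; rewrite mxE ME /a unlift_none mxE.
rewrite eB det1 mul1r ecr; apply/prodf_neq0 => j _.
by rewrite mxE oner_eq0.
Qed.

(** Cramer's rule gives a linear relation between the forms with all coefficients nonzero. Rescaling
    by these coefficients makes the sum zero and keeps the ideal. *)
Lemma general_position_gen l : general_position l ->
  exists b : 'I_r.+1 -> {mpoly K[r]},
  [/\ forall i, b i \is 1.-homog, \sum_i b i = 0,
      forall p : {mpoly K[r]}, p \in square_ideal l <->
        exists g : 'I_r.+1 -> {mpoly K[r]}, p = \sum_i g i * b i ^+ 2 &
      \matrix_(j, k) (b (lift ord0 j))@_U_(k) \in unitmx].
Proof.
rewrite /general_position position_polyE /position_det; set M := coef_mx l.
rewrite mulf_eq0 negb_or => /andP[D0 /prodf_neq0 w0].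
pose c (i : 'I_r.+1) :=
  if unlift ord0 i is Some j then cramer M 0 j else - \det (row' 0 M).
have c0 i : c i != 0.
  by rewrite /c; case: unliftP => [j _|_]; rewrite ?oppr_eq0 // w0.
have lE i : (l i : {mpoly K[r]}) = \sum_k M i k *: 'X_k.
  rewrite {1}(dhomog1_linform (dhomog_is_dhomog (l i))).
  by apply: eq_bigr => k _; rewrite mxE.
exists (fun i => c i *: (l i : {mpoly K[r]})); split.
- by move=> i; apply/rpredZ/dhomog_is_dhomog.
- under eq_bigr => i _ do rewrite lE scaler_sumr.
  rewrite exchange_big big1 //= => k _.
  under eq_bigr => i _ do rewrite scalerA.
  rewrite -scaler_suml big_ord_recl /c unlift_none.
  under eq_bigr => j _ do rewrite liftK.
  have -> : \sum_j cramer M 0 j * M (lift ord0 j) k = \det (row' 0 M) * M ord0 k.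
    transitivity ((cramer M *m row' 0 M) 0 k).
      by rewrite [RHS]mxE; apply: eq_bigr => j _; rewrite [row' 0 M j k]mxE.
    rewrite /cramer -mulmxA mul_adj_mx mul_mx_scalar [LHS]mxE.
    by rewrite [row 0 M 0 k]mxE.
  by rewrite mulNr addNr scale0r.
- move=> p; rewrite unfold_in; split=> [/asboolP[g ->]|[g ->]].
    exists (fun i => (c i ^- 2) *: g i); apply: eq_bigr => i _.
    by rewrite exprZn -scalerAr -scalerAl scalerA mulfV ?scale1r // expf_neq0.
  apply/asboolP; exists (fun i => (c i ^+ 2) *: g i); apply: eq_bigr => i _.
  by rewrite exprZn -scalerAr -scalerAl.
have -> : \matrix_(j, k) (c (lift ord0 j) *: (l (lift ord0 j) : {mpoly K[r]}))@_U_(k)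
    = diag_mx (cramer M) *m row' 0 M.
  apply/matrixP => j k; rewrite mul_diag_mx [LHS]mxE [RHS]mxE mcoeffZ /c liftK.
  by rewrite !mxE.
rewrite unitmx_mul !unitmxE det_diag !unitfE D0 andbT.
by apply/prodf_neq0 => j _; apply: w0.
Qed.

End GeneralPosition.

(** * From ranks of pencils to the Weak Lefschetz Property *)

Section MainTheorem.
Variables (K : closedFieldType) (K_char0 : [pchar K] =i pred0) (r : nat).
Variable l : linear_forms K r.+1 r.
Hypothesis l_gen : general_position l.

Lemma WLP_of_max_rank (a : 'I_r.+1 -> K) : a ord0 != a ord_max ->
  (forall d, max_rank a d) -> has_WLP (square_ideal l).
Proof.
have [b [b1 sb bI bU]] := general_position_gen l_gen.
move=> a0 maxr; apply/(WLPE _ b1 bU); exists a => d.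
case: (maxr d) => [->|full|[k -> inj]].
- by left; apply: inj0 a0.
- by right; apply/(surj_row_full b1 sb bI bU).
- by left; apply/(inj_kermx b1 sb bI bU).
Qed.

Lemma no_WLP d : (forall a : 'I_r.+1 -> K,
    ~~ row_full (pencil d.+1 a) /\
    ~ (forall v : 'rV[K]_#|layer r.+1 d.+1|,
        (v *m up d.+1 a <= up d.+1 (fun=> 1) -> v <= up d (fun=> 1))%MS)) ->
  ~ has_WLP (square_ideal l).
Proof.
have [b [b1 sb bI bU]] := general_position_gen l_gen.
move=> nomax /(WLPE _ b1 bU)[a /(_ d.+1) maxr].
have [/negP nfull ninj] := nomax a.
case: maxr => [inj|surj].
  by apply/ninj/(inj_kermx b1 sb bI bU).
by apply/nfull/(surj_row_full b1 sb bI bU).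
Qed.

End MainTheorem.

Theorem theorem2p12 (K : closedFieldType) (K_char0 : [pchar K] =i pred0)
    (r : nat) (r_ge2 : (2 <= r)%N) :
  ((2 <= r <= 5)%N \/ r = 7%N ->
     for_general_linear_forms
       (fun l : linear_forms K r.+1 r => has_WLP (square_ideal l)))
  /\
  (r = 6%N \/ (8 <= r)%N ->
     for_general_linear_forms
       (fun l : linear_forms K r.+1 r => ~ has_WLP (square_ideal l))).
Proof.
(* One open set serves both parts, since every tuple in it leads to the same presentation. *)
split=> hr; exists (@general_position K r).
  have [a a0 maxr] := exists_max_rank K_char0 hr.
  split; [exact: general_position_open | exact: general_position_ex |].
  by move=> l lgen; apply: WLP_of_max_rank a0 maxr.
have [d nomax] := exists_no_max_rank K_char0 hr.
split; [exact: general_position_open | exact: general_position_ex |].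
by move=> l lgen; apply: no_WLP nomax.
Qed.
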